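(* For any $\phi\in\mathsf{H}(\mathbb{T})$, $$\mathcal{I}(\phi)=\frac12\int_0^1\left[\left(\frac{\phi''(\tau)}{\phi'(\tau)}\right)^2-4\pi^2\phi'(\tau)^2\right]d\tau\ \ge\ -2\pi^2 .$$ Moreover, equality holds if and only if $\phi$ is a Möbius transformation of the unit circle, i.e. $\phi\in\mathrm{PSL}(2,\mathbb{R})$.
   Context: $\mathbb{T}=[0,1]/\{0\sim1\}$ is the unit circle. $\mathrm{Diff}^1(\mathbb{T})$ is the space of orientation preserving $C^1$-diffeomorphisms of $\mathbb{T}$ (identified with $C^1$ maps $\phi:\mathbb{R}\to\mathbb{R}$, modulo integer constants, with $\phi(\tau+1)=\phi(\tau)+1$, $\phi'>0$). $\mathsf{H}(\mathbb{T})=\{\phi\in\mathrm{Diff}^1(\mathbb{T}):\log\phi'\in H^1(\mathbb{T})\}$, where $H^1(\mathbb{T})$ is the Sobolev space; for $\phi\in\mathsf{H}(\mathbb{T})$ the expression $\phi''/\phi'$ denotes the weak derivative $(\log\phi')'$, and $\mathcal{I}(\phi)=\frac12\int_{\mathbb{T}}[((\log\phi')')^2-4\pi^2\phi'^2]\,d\tau$. $\mathrm{PSL}(2,\mathbb{R})$ denotes the group of Möbius transformations of the unit circle: conformal automorphisms of the unit disk restricted to the boundary, identified with $\mathbb{T}$ via $t\mapsto e^{2\pi i t}$. *)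

(* Defs.v *)
From mathcomp Require Import all_boot all_order all_algebra.
From mathcomp Require Import complex.
From mathcomp Require Import all_classical all_reals all_analysis.

Set Implicit Arguments.
Unset Strict Implicit.
Unset Printing Implicit Defensive.

Import Order.TTheory GRing.Theory Num.Theory.
Import numFieldNormedType.Exports.

Local Open Scope ring_scope.
Local Open Scope classical_set_scope.

(* Functions on the circle T = [0,1]/{0 ~ 1} are 1-periodic functions on R,
   and circle diffeomorphisms are represented by their lifts phi : R -> R;
   two lifts of the same diffeomorphism differ by an integer constant, and
   every notion below is invariant under adding such a constant. *)

Section Circle.
Context {R : realType}.
Implicit Types (phi psi u g : R -> R) (t : R).

Definition circle_int u : R := \int[lebesgue_measure]_(t in `[0, 1]) u t.

Definition diff1_circle phi : Prop :=
  [/\ forall t, derivable phi t 1,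
      continuous (derive1 phi),
      forall t, phi (t + 1) = phi t + 1
    & forall t, 0 < derive1 phi t].

Definition L2_circle u : Prop :=
  [/\ periodic u 1, measurable_fun setT u
    & lebesgue_measure.-integrable `[0, 1] (fun t => (u t ^+ 2)%:E)].

Definition test_function psi : Prop :=
  periodic psi 1 /\ forall n t, derivable (derive1n n psi) t 1.

Definition is_weak_derivative u g : Prop :=
  forall psi, test_function psi ->
    circle_int (fun t => u t * derive1 psi t) = - circle_int (fun t => g t * psi t).

Definition H1_circle u : Prop :=
  L2_circle u /\ exists g, L2_circle g /\ is_weak_derivative u g.

(* A chosen representative of the weak derivative of u in H^1(T); it is
   determined up to a Lebesgue-null set, so integrals of expressions in it do
   not depend on the choice. The default value 0 is only used off H^1(T). *)
Definition weak_derive u : R -> R :=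
  xget (cst 0) [set g | L2_circle g /\ is_weak_derivative u g].

Definition ln_derive1 phi : R -> R := fun t => ln (derive1 phi t).

Definition H_circle phi : Prop := diff1_circle phi /\ H1_circle (ln_derive1 phi).

Definition circle_action phi : R :=
  2^-1 * circle_int (fun t =>
    weak_derive (ln_derive1 phi) t ^+ 2 - 4 * pi ^+ 2 * derive1 phi t ^+ 2).

(* The point e^(2 i pi t) of the unit circle. *)
Definition circle_point t : R[i] := (cos (2 * pi * t) +i* sin (2 * pi * t))%C.

Definition unit_disk : set R[i] := [set z | `|z| < 1].

Definition mobius (a b c d z : R[i]) : R[i] := (a * z + b) / (c * z + d).

(* Since x / 0 = 0, the absence of poles in the closed disk is explicit. *)
Definition PSL2R_circle phi : Prop :=
  exists a b c d : R[i],
    [/\ a * d - b * c != 0,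
        forall z, `|z| <= 1 -> c * z + d != 0,
        set_bij unit_disk unit_disk (mobius a b c d)
      & forall t, circle_point (phi t) = mobius a b c d (circle_point t)].

End Circle.

(* Main.v *)
Require Import Defs.
From mathcomp Require Import all_boot all_order all_algebra.
From mathcomp Require Import complex.
From mathcomp Require Import all_classical all_reals all_analysis.
From mathcomp Require Import measurable_realfun.
From mathcomp Require Import ring lra.
Set Implicit Arguments.
Unset Strict Implicit.
Unset Printing Implicit Defensive.
Import Order.TTheory GRing.Theory Num.Theory.
Import numFieldNormedType.Exports.
Local Open Scope ring_scope.
Local Open Scope classical_set_scope.

(* With [f = phi'], the complex curve [z = sqrt f * exp (i pi t)], parametrized by
   [s = phi t] over a period, is antiperiodic, and the inequality is Wirtinger's inequality
   [int |dz/ds|^2 >= pi^2 int |z|^2]. The components of [z] vanish at [t = 0] and [t = 1/2],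
   so for each of them Wirtinger's inequality follows by completing the square with the
   cotangent of [pi (phi t - phi r)], [r] the zero. Everything is expressed in the variable
   [t], where it only uses that [f] is a primitive of [f * (ln f)'], the weak derivative.
   If equality holds then the square for [r = 0] vanishes, which integrates to
   [cot (pi (phi t - phi 0)) = k cot (pi t) + d]: a real Moebius transformation in the
   coordinate [cot (pi t)]. Conversely, for [exp (2 i pi phi) = (a z + b) / (c z + d)] with
   [z = exp (2 i pi t)] one finds [f = m / q] with [q = |c z + d|^2] a trigonometric
   polynomial of degree 1, and the integrand equals [- 4 pi^2 + 2 (ln f)'']. *)

(** * Pointwise derivatives *)

(** The singular cotangent is harmless because a square meets a simple pole. With
    [y = sqrt f * sin (pi (t - r))] seen as a function of [s = phi t], the exact term split off is
    the derivative of [pi * cot (pi (s - phi r)) * y ^+ 2], and [y] vanishes exactly at the poles.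
    For [r = 0] the poles are the ends of the period and no boundary term remains; for [r = 1/2] the
    pole is interior and the terms at the two ends cancel by antiperiodicity. The factor [ds = f dt]
    removes every square root. The obstacle is regularity: the weak derivative is merely an [L^2]
    function tested against smooth periodic functions, and [f] need not be differentiable at any
    prescribed point. Identities of derivatives are therefore replaced by identities of integrals,
    [primitive_on], stable under products and exponentials. Even powers of cosines serve as bump
    functions, since their smoothness, periodicity and primitives are explicit. In the equality case
    the vanishing square is likewise integrated against a continuous factor instead of being
    evaluated at points. *)

Section PointwiseDerivative.
Context {R : realType}.
Implicit Types (F G : R -> R) (t f g : R).

Lemma is_derive1_id t : is_derive t (1 : R) (fun x : R => x) 1.
Proof. exact: is_derive_id. Qed.

Lemma is_derive1_const t (c : R) : is_derive t (1 : R) (fun=> c) 0.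
Proof. exact: is_derive_cst. Qed.

Lemma is_derive1_add F G t f g : is_derive t (1 : R) F f ->
  is_derive t (1 : R) G g -> is_derive t (1 : R) (fun x => F x + G x) (f + g).
Proof. by move=> dF dG; exact: is_deriveD. Qed.

Lemma is_derive1_opp F t f : is_derive t (1 : R) F f ->
  is_derive t (1 : R) (fun x => - F x) (- f).
Proof. by move=> dF; exact: is_deriveN. Qed.

Lemma is_derive1_mul F G t f g : is_derive t (1 : R) F f ->
  is_derive t (1 : R) G g ->
  is_derive t (1 : R) (fun x => F x * G x) (f * G t + F t * g).
Proof.
move=> dF dG; have dFG := is_deriveM dF dG.
by apply: (is_derive_eq dFG); rewrite /GRing.scale/= addrC mulrC.
Qed.

Lemma is_derive1_expn F t f n : is_derive t (1 : R) F f ->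
  is_derive t (1 : R) (fun x => F x ^+ n) (n%:R * F t ^+ n.-1 * f).
Proof.
move=> dF; elim: n => [|n ih]; first by rewrite !mul0r; exact: is_derive1_const.
have -> : (fun x => F x ^+ n.+1) = (fun x => F x * F x ^+ n).
  by apply/funext => x; rewrite exprS.
apply: (is_derive_eq (is_derive1_mul dF ih)).
case: n {ih} => [|n] /=; first by rewrite expr0; ring.
by rewrite [n.+2%:R]mulrS exprS; ring.
Qed.

Lemma is_derive1_inv F t f : F t != 0 -> is_derive t (1 : R) F f ->
  is_derive t (1 : R) (fun x => (F x)^-1) (- f / F t ^+ 2).
Proof.
move=> Ft [df vf]; apply: DeriveDef; first exact: derivableV.
by rewrite deriveV// vf /GRing.scale/=; field.
Qed.

Lemma is_derive1_div F G t f g : G t != 0 -> is_derive t (1 : R) F f ->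
  is_derive t (1 : R) G g ->
  is_derive t (1 : R) (fun x => F x / G x) ((f * G t - F t * g) / G t ^+ 2).
Proof.
move=> Gt dF dG.
by apply: (is_derive_eq (is_derive1_mul dF (is_derive1_inv Gt dG))); field.
Qed.

Lemma is_derive1_sin F t f : is_derive t (1 : R) F f ->
  is_derive t (1 : R) (fun x => sin (F x)) (cos (F t) * f).
Proof. by move=> dF; exact: (is_derive1_comp (is_derive_sin _) dF). Qed.

Lemma is_derive1_cos F t f : is_derive t (1 : R) F f ->
  is_derive t (1 : R) (fun x => cos (F x)) (- sin (F t) * f).
Proof. by move=> dF; exact: (is_derive1_comp (is_derive_cos _) dF). Qed.

End PointwiseDerivative.

(* The library instances of [is_derive] produce derivatives in terms of [*:];
   [notypeclasses] keeps them from being selected. *)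
Ltac derive1_rules := repeat first
  [ eassumption
  | notypeclasses refine (is_derive1_id _)
  | notypeclasses refine (is_derive1_const _ _)
  | notypeclasses refine (is_derive1_sin _)
  | notypeclasses refine (is_derive1_cos _)
  | notypeclasses refine (is_derive1_div _ _ _)
  | notypeclasses refine (is_derive1_inv _ _)
  | notypeclasses refine (is_derive1_add _ _)
  | notypeclasses refine (is_derive1_opp _)
  | notypeclasses refine (is_derive1_expn _ _)
  | notypeclasses refine (is_derive1_mul _ _) ].

Ltac derive1 := notypeclasses refine (is_derive_eq _ _); [derive1_rules|rewrite /=].

(** * Primitives of Lebesgue integrable functions *)

Section Primitive.
Context {R : realType}.
Notation mu := (@lebesgue_measure R).
Implicit Types (F f G g h : R -> R) (a b x y : R).

Lemma integrable_sub_itv a b x y f : a <= x -> y <= b ->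
  mu.-integrable `[a, b] (EFin \o f) -> mu.-integrable `[x, y] (EFin \o f).
Proof.
move=> ax yb; apply: integrableS => //.
by apply: subset_itv; rewrite bnd_simp.
Qed.

Lemma Rintegral_itv_cat a b x y z f : a <= x -> x <= y -> y <= z -> z <= b ->
  mu.-integrable `[a, b] (EFin \o f) ->
  \int[mu]_(t in `[x, z]) f t =
  \int[mu]_(t in `[x, y]) f t + \int[mu]_(t in `[y, z]) f t.
Proof.
move=> ax xy yz zb fi.
have fi' := integrable_sub_itv ax zb fi.
apply/eqP; rewrite addrC -subr_eq; apply/eqP.
rewrite (Rintegral_itvB (x := y) fi') ?bnd_simp//.
rewrite Rintegral_itv_obnd_cbnd//.
by apply: integrableS fi' => //; apply: subset_itvr; rewrite bnd_simp.
Qed.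

Lemma within_continuous_bounded a b h : {within `[a, b], continuous h} ->
  exists2 M : R, 0 < M & forall x, a <= x <= b -> `|h x| <= M.
Proof.
move=> ch.
have [ab|ba] := leP a b; last first.
  by exists 1 => // x /andP[ax xb]; move: (le_trans ax xb); rewrite leNgt ba.
have cn : {within `[a, b], continuous (fun x => `|h x|)}.
  by move=> x; apply: continuous_comp; [exact: ch|exact: norm_continuous].
have [c _ cP] := EVT_max ab cn.
exists (`|h c| + 1); first by rewrite ltr_wpDl.
by move=> x xab; rewrite (le_trans (cP x _)) ?lerDl// in_itv.
Qed.

Lemma integrable_continuousM a b h f : {within `[a, b], continuous h} ->
  mu.-integrable `[a, b] (EFin \o f) ->
  mu.-integrable `[a, b] (EFin \o (fun t => h t * f t)).
Proof.
move=> ch fi.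
have [M M0 hM] := within_continuous_bounded ch.
have -> : EFin \o (fun t => h t * f t) = ((EFin \o h) \* (EFin \o f))%E by [].
apply: integrableMr => //.
  by apply: subspace_continuous_measurable_fun.
exists M; split => [|x Mx y/= yab]; first exact: num_real.
by rewrite (le_trans (hM _ _)) ?(ltW Mx)//; move: yab; rewrite in_itv.
Qed.

Lemma within_continuous_integrable a b h : {within `[a, b], continuous h} ->
  mu.-integrable `[a, b] (EFin \o h).
Proof.
move=> ch; apply: continuous_compact_integrable => //.
exact: segment_compact.
Qed.

Lemma within_continuousP a b F : {within `[a, b], continuous F} <->
  forall x e, a <= x <= b -> 0 < e -> exists2 d : R, 0 < d &
    forall y, a <= y <= b -> `|y - x| < d -> `|F y - F x| < e.
Proof.
split=> [/subspace_continuousP cF x e xab e0|cF].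
  have /cvgrPdist_lt/(_ _ e0) : F y @[y --> within `[a, b] (nbhs x)] --> F x.
    by apply: cF; rewrite /= in_itv.
  rewrite near_withinE => -[d /= d0 dP].
  exists d => // y yab yx; rewrite distrC; apply: dP => /=.
    by rewrite distrC.
  by rewrite in_itv.
apply/subspace_continuousP => x /=; rewrite in_itv/= => xab.
apply/cvgrPdist_lt => e e0; have [d d0 dP] := cF x e xab e0.
rewrite near_withinE; exists d => // y /= yx; rewrite in_itv/= => yab.
by rewrite distrC; apply: dP => //; rewrite distrC.
Qed.

(* Replaces a differentiation argument, [F] being differentiable only almost everywhere.
   [G] is meant to be a primitive of some [|h|] with [h] integrable, hence the comparison of
   increments instead of a bound by [t - s]. *)
Lemma straddle_eq a b F f G : a <= b -> mu.-integrable `[a, b] (EFin \o f) ->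
  (forall x e, a <= x <= b -> 0 < e -> exists2 d : R, 0 < d &
    forall s t, a <= s -> s <= x -> x <= t -> t <= b -> x - s < d -> t - x < d ->
      `|F t - F s - \int[mu]_(r in `[s, t]) f r| <= e * (G t - G s)) ->
  F b - F a = \int[mu]_(r in `[a, b]) f r.
Proof.
move=> ab fi loc.
pose D t := F t - F a - \int[mu]_(r in `[a, t]) f r.
have DB s t : a <= s -> s <= t -> t <= b ->
    D t - D s = F t - F s - \int[mu]_(r in `[s, t]) f r.
  by move=> as_ st tb; rewrite /D (Rintegral_itv_cat (lexx a) as_ st tb fi); ring.
have Da : D a = 0 by rewrite /D set_itv1 Rintegral_set1 !subrr.
suff Db e : 0 < e -> `|D b| <= e * (G b - G a).
  apply/eqP; rewrite -subr_eq0 -/(D b) -normr_le0.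
  apply/ler_addgt0Pr => e e0; rewrite add0r.
  have G0 : 0 <= G b - G a.
    by have := Db 1 ltr01; rewrite mul1r; exact: le_trans.
  have e'0 : 0 < e / (G b - G a + 1) by rewrite divr_gt0// ltr_wpDl.
  apply: (le_trans (Db _ e'0)); rewrite mulrAC ler_pdivrMr ?ltr_wpDl//.
  by rewrite ler_pM2l// lerDl.
move=> e0.
(* Continuous induction: [loc] carries [T] from a point just below [s = sup T] to [s], and then past
   [s] unless [s = b]. *)
pose T := [set t | a <= t <= b /\ `|D t| <= e * (G t - G a)].
have Ta : T a by split; [rewrite lexx|rewrite Da normr0 subrr mulr0].
have Tb : ubound T b by move=> t [/andP[]].
have supT : has_sup T by split; [exists a|exists b].
set s := sup T.
have as_ : a <= s by apply: ub_le_sup => //; exists b.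
have sb : s <= b by apply: ge_sup => //; exists a.
have step u v : T u -> u <= v -> v <= b ->
    `|D v - D u| <= e * (G v - G u) -> T v.
  move=> [/andP[au ub] Du] uv vb Duv; split.
    by rewrite (le_trans au uv).
  have -> : D v = D v - D u + D u by rewrite subrK.
  apply: (le_trans (ler_normD _ _)); apply: (le_trans (lerD Duv Du)).
  by rewrite -mulrDr; lra.
have [d d0 dP] := loc s e (introT andP (conj as_ sb)) e0.
have [t Tt st] := sup_adherent d0 supT; rewrite -/s in st.
have [/andP[at_ tb] _] := Tt.
have ts : t <= s by apply: ub_le_sup => //; exists b.
have Ts : T s.
  by apply: (step t s) => //; rewrite DB//; apply: dP => //; lra.
have [bs|] := leP b s.
  by have -> : b = s by [apply/eqP; rewrite eq_le bs sb]; case: Ts.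
move=> sb'.
pose v := Num.min b (s + d / 2).
have sv : s < v by rewrite lt_min sb' ltrDl divr_gt0.
have vb : v <= b by rewrite ge_min lexx.
have vd : v <= s + d / 2 by rewrite ge_min lexx orbT.
have : T v.
  apply: (step s v) => //; first exact: ltW.
  rewrite DB//; last exact: ltW.
  by clear -d0 vd st sv sb dP as_ vb; apply: dP => //; [exact: ltW|lra|lra].
move=> Tv; have : v <= s by apply: ub_le_sup => //; exists b.
by rewrite leNgt sv.
Qed.

(** Absolute continuity with a chosen density, phrased by integrals so that [f] matters only up to a
    null set. *)
Definition primitive_on a b F f : Prop :=
  [/\ {within `[a, b], continuous F}, mu.-integrable `[a, b] (EFin \o f) &
    forall x y, a <= x -> x <= y -> y <= b ->
      F y - F x = \int[mu]_(t in `[x, y]) f t].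

Lemma primitive_on_sub a b x y F f : a <= x -> y <= b ->
  primitive_on a b F f -> primitive_on x y F f.
Proof.
move=> ax yb [cF fi Ff]; split.
- by apply: continuous_subspaceW cF; apply: subset_itv; rewrite bnd_simp.
- exact: integrable_sub_itv fi.
- by move=> u v xu uv vy; apply: Ff => //; [exact: le_trans xu|exact: le_trans yb].
Qed.

Lemma continuous_primitive_on a b F f :
  (forall t : R, a <= t <= b -> is_derive t (1 : R) F (f t)) ->
  {within `[a, b], continuous f} -> primitive_on a b F f.
Proof.
move=> dF cf.
have cF t : a <= t <= b -> {for t, continuous F}.
  move=> tab; apply: differentiable_continuous.
  by apply/derivable1_diffP; have [] := dF t tab.
split.
- apply: continuous_in_subspaceT => t; rewrite inE/= in_itv/= => tab.
  exact: cF.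
- exact: within_continuous_integrable.
move=> x y ax xy yb.
have sub t : x <= t <= y -> a <= t <= b.
  by move=> /andP[xt ty]; rewrite (le_trans ax xt) (le_trans ty yb).
move: xy; rewrite le_eqVlt => /predU1P[->|xy].
  by rewrite subrr set_itv1 Rintegral_set1.
rewrite /Rintegral (@continuous_FTC2 _ f F)//.
- by apply: continuous_subspaceW cf; apply: subset_itv; rewrite bnd_simp.
- split.
  + move=> t; rewrite in_itv/= => /andP[xt ty].
    by have [] // := dF t _; apply: sub; rewrite !ltW.
  + by apply: cvg_at_right_filter; apply: cF; apply: sub; rewrite lexx ltW.
  + by apply: cvg_at_left_filter; apply: cF; apply: sub; rewrite lexx ltW.
- move=> t; rewrite in_itv/= => /andP[xt ty]; rewrite derive1E.
  have tab : a <= t <= b by apply: sub; rewrite !ltW.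
  by have /@derive_val := dF t tab.
Qed.

Lemma integrable_EFinD a b f g : mu.-integrable `[a, b] (EFin \o f) ->
  mu.-integrable `[a, b] (EFin \o g) ->
  mu.-integrable `[a, b] (EFin \o (fun t => f t + g t)).
Proof. by move=> fi gi; exact: (integrableD _ fi gi). Qed.

Lemma integrable_EFinB a b f g : mu.-integrable `[a, b] (EFin \o f) ->
  mu.-integrable `[a, b] (EFin \o g) ->
  mu.-integrable `[a, b] (EFin \o (fun t => f t - g t)).
Proof. by move=> fi gi; exact: (integrableB _ fi gi). Qed.

(** Freezing a continuous factor costs its oscillation times the mass of [f]. This is the local
    estimate that [straddle_eq] asks for, with [G] a primitive of [|f|]. *)
Lemma Rintegral_near_cst s t c e f h : s <= t ->
  {within `[s, t], continuous h} -> mu.-integrable `[s, t] (EFin \o f) ->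
  (forall r, s <= r <= t -> `|h r - c| <= e) ->
  `|\int[mu]_(r in `[s, t]) (h r * f r) - c * \int[mu]_(r in `[s, t]) f r|
    <= e * \int[mu]_(r in `[s, t]) `|f r|.
Proof.
move=> st ch fi hc.
have hfi := integrable_continuousM ch fi.
have cfi : mu.-integrable `[s, t] (EFin \o (fun r => c * f r)).
  by apply: integrable_continuousM => //; exact: cst_continuous.
have nfi : mu.-integrable `[s, t] (EFin \o (fun r => `|f r|)).
  exact: integrable_norm.
rewrite -RintegralZl// -RintegralB//.
have di : mu.-integrable `[s, t] (EFin \o (fun r => h r * f r - c * f r)).
  exact: integrable_EFinB.
apply: (le_trans (le_normr_Rintegral _ di)) => //.
rewrite -RintegralZl//; apply: le_Rintegral => //.
- exact: integrable_norm.
- by apply: integrable_continuousM => //; exact: cst_continuous.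
- move=> r; rewrite /= in_itv/= => rst.
  by rewrite -mulrBl normrM ler_wpM2r// hc.
Qed.

Lemma Rintegral_subB a b s t f : a <= s -> s <= t -> t <= b ->
  mu.-integrable `[a, b] (EFin \o f) ->
  \int[mu]_(r in `[s, t]) f r =
  \int[mu]_(r in `[a, t]) f r - \int[mu]_(r in `[a, s]) f r.
Proof.
by move=> as_ st tb fi; rewrite (Rintegral_itv_cat (lexx a) as_ st tb fi); ring.
Qed.

Lemma within_continuousM a b F G : {within `[a, b], continuous F} ->
  {within `[a, b], continuous G} ->
  {within `[a, b], continuous (fun t => F t * G t)}.
Proof. by move=> cF cG x; apply: continuousM; [exact: cF|exact: cG]. Qed.

Lemma within_continuous_osc a b F z e : {within `[a, b], continuous F} ->
  a <= z <= b -> 0 < e -> exists2 d : R, 0 < d &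
    forall s t u v, a <= s -> t <= b -> z - s < d -> t - z < d ->
      s <= u <= t -> s <= v <= t -> `|F u - F v| <= e.
Proof.
move=> /within_continuousP cF zab e0.
have e2 : 0 < e / 2 by rewrite divr_gt0.
have [d d0 dP] := cF z _ zab e2.
have close s t u : a <= s -> t <= b -> z - s < d -> t - z < d -> s <= u <= t ->
    `|F u - F z| < e / 2.
  move=> as_ tb zs tz /andP[su ut].
  apply: dP; first by rewrite (le_trans as_ su) (le_trans ut tb).
  by rewrite ltr_norml; clear -zs tz su ut; apply/andP; split; lra.
exists d => // s t u v as_ tb zs tz /close hu /close hv.
have -> : F u - F v = (F u - F z) - (F v - F z) by ring.
apply: (le_trans (ler_normB _ _)); rewrite ltW// (splitr e) ltrD//.
  exact: hu.
exact: hv.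
Qed.

(** The increment over [[s, t]] is [H t * (F t - F s) + F s * (H t - H s)], two integrals with a
    frozen continuous factor. The comparison function [N] is accordingly a primitive of
    [|f| + |h|]. *)
Lemma primitive_onM a b F f H h : primitive_on a b F f -> primitive_on a b H h ->
  primitive_on a b (fun t => F t * H t) (fun t => H t * f t + F t * h t).
Proof.
move=> pF pH; have [cF fi Ff] := pF; have [cH hi Hh] := pH.
have Hfi := integrable_continuousM cH fi.
have Fhi := integrable_continuousM cF hi.
have sumi : mu.-integrable `[a, b] (EFin \o (fun t => H t * f t + F t * h t)).
  exact: integrable_EFinD.
split => //; first exact: within_continuousM.
move=> x y ax xy yb.
have nfi : mu.-integrable `[a, b] (EFin \o (fun r => `|f r|)).
  exact: integrable_norm.
have nhi : mu.-integrable `[a, b] (EFin \o (fun r => `|h r|)).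
  exact: integrable_norm.
pose N t := \int[mu]_(r in `[a, t]) `|f r| + \int[mu]_(r in `[a, t]) `|h r|.
apply: (@straddle_eq x y (fun t => F t * H t) _ N) => //.
  exact: integrable_sub_itv sumi.
move=> z e /andP[xz zy] e0.
have zab : a <= z <= b by rewrite (le_trans ax xz) (le_trans zy yb).
have [d1 d10 d1P] := within_continuous_osc cF zab e0.
have [d2 d20 d2P] := within_continuous_osc cH zab e0.
exists (Num.min d1 d2); first by rewrite lt_min d10 d20.
move=> s t xs sz zt ty; rewrite !lt_min => /andP[zs1 zs2] /andP[tz1 tz2].
have st := le_trans sz zt.
have as_ := le_trans ax xs.
have tb := le_trans ty yb.
have [cFst fist Ffst] := primitive_on_sub as_ tb pF.
have [cHst hist Hhst] := primitive_on_sub as_ tb pH.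
rewrite RintegralD//; [|exact: integrable_sub_itv Hfi|exact: integrable_sub_itv Fhi].
have -> : N t - N s =
    \int[mu]_(r in `[s, t]) `|f r| + \int[mu]_(r in `[s, t]) `|h r|.
  by rewrite /N (Rintegral_subB as_ st tb nfi) (Rintegral_subB as_ st tb nhi); ring.
have -> : F t * H t - F s * H s = H t * (F t - F s) + F s * (H t - H s) by ring.
rewrite Ff// Hh//.
have h1 := Rintegral_near_cst (c := H t) (e := e) st cHst fist.
have h2 := Rintegral_near_cst (c := F s) (e := e) st cFst hist.
have st1 : s <= t <= t by rewrite st lexx.
have st2 : s <= s <= t by rewrite st lexx.
have {}h1 := h1 (fun r rst => d2P s t r t as_ tb zs2 tz2 rst st1).
have {}h2 := h2 (fun r rst => d1P s t r s as_ tb zs1 tz1 rst st2).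
rewrite mulrDr; apply: le_trans (lerD h1 h2).
rewrite -normrN; apply: le_trans (ler_normD _ _).
by rewrite le_eqVlt; apply/orP; left; apply/eqP; congr Num.norm; ring.
Qed.

(** The mean value theorem with the intermediate point eliminated: the slope obeys every bound
    common to the two values, whichever of [x] and [y] is larger. *)
Lemma expR_slope (x y : R) : exists2 c, expR y - expR x = c * (y - x) &
  forall m M, m <= expR x <= M -> m <= expR y <= M -> m <= c <= M.
Proof.
wlog xy : x y / x <= y.
  move=> H; have [/H//|/ltW/H[c cE cP]] := leP x y.
  exists c; last by move=> m M h1 h2; exact: cP.
  by rewrite -[LHS]opprB cE; ring.
have [c cxy cE] : exists2 c, c \in `[x, y]%R & expR y - expR x = expR c * (y - x).
  by apply: MVT_segment => //; apply: continuous_subspaceT; exact: continuous_expR.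
exists (expR c) => // m M /andP[mx _] /andP[_ yM].
move: cxy; rewrite in_itv/= => /andP[xc cy].
by rewrite (le_trans mx) ?(le_trans _ yM)// ler_expR.
Qed.

(** Passes from [ln f] to [f]. The slope of the exponential over [[s, t]] is close to each value
    [expR (F r)] there, so the increment is again an integral with a frozen factor. *)
Lemma primitive_on_expR a b F f : primitive_on a b F f ->
  primitive_on a b (fun t => expR (F t)) (fun t => expR (F t) * f t).
Proof.
move=> pF; have [cF fi Ff] := pF.
have cE : {within `[a, b], continuous (fun t => expR (F t))}.
  by move=> t; apply: continuous_comp; [exact: cF|exact: continuous_expR].
have Efi := integrable_continuousM cE fi.
split => //.
move=> x y ax xy yb.
have nfi : mu.-integrable `[a, b] (EFin \o (fun r => `|f r|)).
  exact: integrable_norm.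
pose N t := \int[mu]_(r in `[a, t]) `|f r|.
apply: (@straddle_eq x y (fun t => expR (F t)) _ N) => //.
  exact: integrable_sub_itv Efi.
move=> z e /andP[xz zy] e0.
have zab : a <= z <= b by rewrite (le_trans ax xz) (le_trans zy yb).
have [d d0 dP] := within_continuous_osc cE zab e0.
exists d => // s t xs sz zt ty zs tz.
have st := le_trans sz zt.
have as_ := le_trans ax xs.
have tb := le_trans ty yb.
have [c cE' cP] := expR_slope (F s) (F t).
have [cFst fist Ffst] := primitive_on_sub as_ tb pF.
have cEst : {within `[s, t], continuous (fun t => expR (F t))}.
  by apply: continuous_subspaceW cE; apply: subset_itv; rewrite bnd_simp.
rewrite cE' Ff// distrC /N -(Rintegral_subB as_ st tb nfi).
apply: Rintegral_near_cst => // r rst.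
have near u : s <= u <= t ->
    expR (F r) - e <= expR (F u) <= expR (F r) + e.
  by move=> ust; rewrite -ler_distl; apply: dP zs tz _ _.
have /andP[c1 c2] := cP _ _ (near s (introT andP (conj (lexx s) st)))
  (near t (introT andP (conj st (lexx t)))).
by rewrite distrC ler_distl c1 c2.
Qed.
End Primitive.

(** * From weak derivatives to primitives *)

Section SmoothFunctions.
Context {R : realType}.
Implicit Types (F G : R -> R) (w th : R).

(* Bounded order of differentiability is what makes the Leibniz rule an induction. *)
Definition derivable_upto (n : nat) F : Prop :=
  forall k, (k <= n)%N -> forall t : R, derivable (F^`(k)) t (1 : R).

Lemma derivable_uptoS n F : derivable_upto n.+1 F <->
  (forall t : R, derivable F t (1 : R)) /\ derivable_upto n (F^`()).
Proof.
split=> [dF|[dF dF'] [|k] kn]; last 2 first.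
- by move=> t; exact: dF.
- by move=> t; rewrite derive1Sn; exact: dF'.
split=> [t|k kn t]; first exact: (dF 0%N).
by rewrite -derive1Sn; exact: dF.
Qed.

Lemma derivable_uptoW n F : derivable_upto n.+1 F -> derivable_upto n F.
Proof. by move=> dF k kn; apply: dF; rewrite (leq_trans kn). Qed.

Lemma derivable_upto_derive1 n F t : derivable_upto n F ->
  is_derive t (1 : R) F (derive1 F t).
Proof. by move=> dF; rewrite derive1E; apply: derivableP; exact: (dF 0%N). Qed.

Lemma derive1_fun F f : (forall t : R, is_derive t (1 : R) F (f t)) -> F^`() = f.
Proof. by move=> dF; apply/funext => t; rewrite derive1E derive_val. Qed.

Lemma derivable_upto0 F f : (forall t : R, is_derive t (1 : R) F (f t)) ->
  derivable_upto 0 F.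
Proof. by move=> dF k; rewrite leqn0 => /eqP -> t; have [] := dF t. Qed.

Lemma derivable_upto_step n F f : (forall t : R, is_derive t (1 : R) F (f t)) ->
  derivable_upto n f -> derivable_upto n.+1 F.
Proof.
move=> dF df; apply/derivable_uptoS; split; first by move=> t; have [] := dF t.
by rewrite (derive1_fun dF).
Qed.

Lemma derivable_uptoD n F G : derivable_upto n F -> derivable_upto n G ->
  derivable_upto n (fun t => F t + G t).
Proof.
elim: n F G => [|n ih] F G dF dG.
  apply: derivable_upto0 => t.
  exact: is_derive1_add (derivable_upto_derive1 t dF) (derivable_upto_derive1 t dG).
refine (@derivable_upto_step n _ (fun t => derive1 F t + derive1 G t) _ _) => [t|].
  exact: is_derive1_add (derivable_upto_derive1 t dF) (derivable_upto_derive1 t dG).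
by apply: ih; [have /derivable_uptoS[] := dF|have /derivable_uptoS[] := dG].
Qed.

Lemma derivable_uptoM n F G : derivable_upto n F -> derivable_upto n G ->
  derivable_upto n (fun t => F t * G t).
Proof.
elim: n F G => [|n ih] F G dF dG.
  apply: derivable_upto0 => t.
  exact: is_derive1_mul (derivable_upto_derive1 t dF) (derivable_upto_derive1 t dG).
refine (@derivable_upto_step n _ (fun t => derive1 F t * G t + F t * derive1 G t) _ _) => [t|].
  exact: is_derive1_mul (derivable_upto_derive1 t dF) (derivable_upto_derive1 t dG).
have [_ dF'] := (derivable_uptoS _ _).1 dF.
have [_ dG'] := (derivable_uptoS _ _).1 dG.
exact: (derivable_uptoD (ih _ _ dF' (derivable_uptoW dG)) (ih _ _ (derivable_uptoW dF) dG')).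
Qed.

Lemma derivable_upto_cst n (c : R) : derivable_upto n (fun=> c).
Proof.
elim: n c => [|n ih] c.
  by apply: (@derivable_upto0 _ (fun=> 0)) => t; exact: is_derive1_const.
by apply: (@derivable_upto_step _ _ (fun=> 0)).
Qed.

Lemma derivable_upto_cos n w th : derivable_upto n (fun t => cos (w * t + th)).
Proof.
have dcos v s (t : R) : is_derive t (1 : R) (fun t => cos (v * t + s))
    (v * cos (v * t + (s + pi / 2))).
  by derive1; rewrite addrA cosDpihalf; ring.
elim: n th => [|n ih] th; first by apply: derivable_upto0 => t; exact: dcos.
apply: (derivable_upto_step (dcos w th)).
by apply: derivable_uptoM; [exact: derivable_upto_cst|exact: ih].
Qed.

Lemma test_functionP (psi : R -> R) : test_function psi <->
  periodic psi 1 /\ forall n, derivable_upto n psi.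
Proof.
split=> -[per_psi dpsi]; split=> // n.
  by move=> k _ t; exact: dpsi.
by move=> t; exact: (dpsi n n).
Qed.

Lemma test_functionB (psi chi : R -> R) : test_function psi -> test_function chi ->
  test_function (fun t => psi t - chi t).
Proof.
move=> /test_functionP[pp dp] /test_functionP[pc dc]; apply/test_functionP.
split=> [t|n]; first by rewrite pp pc.
apply: derivable_uptoD => //.
have -> : (fun t => - chi t) = (fun t => -1 * chi t).
  by apply/funext => t; rewrite mulN1r.
by apply: derivable_uptoM; first exact: derivable_upto_cst.
Qed.

Lemma test_function_cst (c : R) : test_function (fun=> c : R).
Proof. by apply/test_functionP; split=> // n; exact: derivable_upto_cst. Qed.

(** Periodic of period 1 because the exponent is even, and concentrating at [a] modulo 1 as [n]
    grows: divided by its mean, an approximate identity made of trigonometric polynomials. *)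
Definition peak (a : R) n (t : R) : R := cos (pi * (t - a)) ^+ n.*2.

Lemma peak_periodic a n : periodic (peak a n) 1.
Proof.
move=> t; rewrite /peak.
have -> : pi * (t + 1 - a) = pi * (t - a) + pi by ring.
by rewrite cosDpi -mul2n !exprM sqrrN.
Qed.

Lemma derivable_upto_peak m a n : derivable_upto m (peak a n).
Proof.
have dcos : derivable_upto m (fun t => cos (pi * (t - a))).
  have -> : (fun t => cos (pi * (t - a))) = (fun t => cos (pi * t + - (pi * a))).
    by apply/funext => t; rewrite mulrBr.
  exact: derivable_upto_cos.
rewrite /peak; elim: n.*2 => [|k ih]; first by rewrite /=; exact: derivable_upto_cst.
have -> : (fun t => cos (pi * (t - a)) ^+ k.+1) =
    (fun t => cos (pi * (t - a)) * cos (pi * (t - a)) ^+ k).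
  by apply/funext => t; rewrite exprS.
exact: (derivable_uptoM dcos ih).
Qed.

(* Reduction formula: [(s c^(2n+1))' = pi ((2n+2) c^(2n+2) - (2n+1) c^(2n))] for [s] and [c]
   the sine and cosine of [pi (t - a)]. *)
Lemma peak_primitive n : exists m, forall a, exists2 psi : R -> R, test_function psi &
  forall t, is_derive t (1 : R) psi (peak a n t - m).
Proof.
elim: n => [|n [m ih]].
  exists 1 => a; exists (fun=> 0) => [|t]; first exact: test_function_cst.
  by rewrite /peak expr0 subrr; exact: is_derive1_const.
pose k : R := n.*2.+2%:R; pose l : R := n.*2.+1%:R.
have k0 : k != 0 by rewrite pnatr_eq0.
have pi0 : pi != 0 :> R by rewrite gt_eqF// pi_gt0.
exists (l / k * m) => a.
have [psi /test_functionP[pp dp] dpsi] := ih a.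
pose sc t := sin (pi * (t - a)) * cos (pi * (t - a)).
exists (fun t => l / k * psi t + (pi * k)^-1 * (sc t * peak a n t)).
  apply/test_functionP; split=> [t|r].
    rewrite pp peak_periodic /sc.
    have -> : pi * (t + 1 - a) = pi * (t - a) + pi by ring.
    by rewrite cosDpi sinDpi mulrNN.
  apply: derivable_uptoD.
    by apply: derivable_uptoM => //; exact: derivable_upto_cst.
  apply: derivable_uptoM; first exact: derivable_upto_cst.
  apply: derivable_uptoM; last exact: derivable_upto_peak.
  have -> : sc = (fun t => cos (pi * t + (- (pi * a) - pi / 2)) *
                           cos (pi * t + - (pi * a))).
    apply/funext => t; rewrite addrA cosBpihalf /sc.
    by have -> : pi * t + - (pi * a) = pi * (t - a) by ring.
  by apply: derivable_uptoM; exact: derivable_upto_cos.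
move=> t; rewrite /sc /peak; have dpsit := dpsi t.
derive1.
rewrite doubleS; set s := sin _; set c := cos _; set N := n.*2.
have s2 : s ^+ 2 = 1 - c ^+ 2 by rewrite /s sin2cos2.
have cN : N%:R * c ^+ N.-1 * c = N%:R * c ^+ N.
  by case: N => [|N]; rewrite ?mul0r// -mulrA -exprSr.
have kE : k = N%:R + 2 by rewrite /k -addn2 natrD.
have lE : l = N%:R + 1 by rewrite /l -addn1 natrD.
transitivity (l / k * (c ^+ N - m) + k^-1 *
    ((c ^+ 2 - s ^+ 2) * c ^+ N - (N%:R * c ^+ N.-1 * c) * s ^+ 2)).
  rewrite -[peak a n t]/(c ^+ N); clearbody k l s c N.
  by move: (pi : R) pi0 => p p0; field; apply/andP.
have -> : c ^+ N.+2 = c ^+ 2 * c ^+ N by rewrite -exprD.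
rewrite cN s2; rewrite kE in k0; rewrite kE lE.
by field.
Qed.

End SmoothFunctions.

(** * Testing a weak derivative against concentrating peaks *)

Section WeakDerivative.
Context {R : realType}.
Notation mu := (@lebesgue_measure R).
Implicit Types (F f g v w : R -> R) (a b d e t x y : R).

Lemma ler_cos_pi x y : 0 <= x -> x <= y -> y <= 1 -> cos (pi * y) <= cos (pi * x).
Proof.
move=> x0; rewrite le_eqVlt => /predU1P[->//|xy] y1.
have p0 := pi_gt0 R.
rewrite ltW// ltr_cos ?ltr_pM2l// in_itv/=.
  by rewrite mulr_ge0 ?(ltW p0)//= ler_piMr// ?(ltW p0)// (le_trans (ltW xy)).
by rewrite mulr_ge0 ?(ltW p0)//= ?(le_trans x0 (ltW xy))// ler_piMr ?(ltW p0).
Qed.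

Lemma cos_pi_norm x : cos (pi * x) = cos (pi * `|x|).
Proof.
by rewrite -cos_norm normrM (ger0_norm (ltW (pi_gt0 R))).
Qed.

Lemma cos_pi_ge0 x : 0 <= x -> x <= 2^-1 -> 0 <= cos (pi * x).
Proof.
move=> x0 x2; have p0 := pi_gt0 R.
rewrite cos_ge0_pihalf// ler_pM2l// x2 andbT.
by rewrite (@le_trans _ _ 0) ?oppr_le0 ?divr_ge0 ?mulr_ge0// ltW.
Qed.

Lemma peak_le a n d t : 0 <= d -> d <= `|t - a| -> `|t - a| <= 1 - d ->
  peak a n t <= (cos (pi * d) ^+ 2) ^+ n.
Proof.
move=> d0 dt td; rewrite /peak -mul2n exprM lerXn2r ?nnegrE ?sqr_ge0//.
rewrite (cos_pi_norm (t - a)) -[leLHS]real_normK ?num_real// lerXn2r ?nnegrE//.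
  by apply: cos_pi_ge0 => //; have := le_trans dt td; clear; lra.
rewrite ler_norml; apply/andP; split.
  have <- : cos (pi * (1 - d)) = - cos (pi * d).
    by rewrite mulrBr mulr1 cosB cospi sinpi mulN1r mul0r addr0.
  by apply: ler_cos_pi => //; rewrite gerBl.
by apply: ler_cos_pi => //; rewrite (le_trans td)// gerBl.
Qed.

Lemma peak_ge a n d t : `|t - a| <= d -> d <= 2^-1 ->
  (cos (pi * d) ^+ 2) ^+ n <= peak a n t.
Proof.
move=> td d2; rewrite /peak -mul2n exprM lerXn2r ?nnegrE ?sqr_ge0//.
rewrite (cos_pi_norm (t - a)).
have c0 : 0 <= cos (pi * d) by apply: cos_pi_ge0 => //; exact: le_trans td.
have h : cos (pi * d) <= cos (pi * `|t - a|).
  by apply: ler_cos_pi => //; rewrite (le_trans d2)//; lra.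
by rewrite lerXn2r ?nnegrE// (le_trans c0).
Qed.

Lemma peak_ge0 a n t : 0 <= peak a n t.
Proof. by rewrite /peak -mul2n exprM exprn_ge0// sqr_ge0. Qed.

Lemma continuous_peak a n : continuous (peak a n).
Proof.
move=> t; apply: differentiable_continuous; apply/derivable1_diffP.
by have [] := derivable_upto_derive1 t (@derivable_upto_peak _ 0 a n).
Qed.

Lemma within_continuous_peak a n x y : {within `[x, y], continuous (peak a n)}.
Proof. by apply: continuous_subspaceT; exact: continuous_peak. Qed.

Lemma Rintegral_peak n : exists m, forall a,
  \int[mu]_(t in `[0, 1]) peak a n t = m.
Proof.
have [m mP] := @peak_primitive R n; exists m => a.
have [psi [per_psi _] dpsi] := mP a.
have cp : {within `[0%R, 1%R], continuous (fun t => peak a n t - m)}.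
  apply: continuous_subspaceT => t; apply: continuousB.
    exact: continuous_peak.
  exact: cst_continuous.
have [_ _ /(_ 0 1)] : primitive_on 0 1 psi (fun t => peak a n t - m).
  by apply: continuous_primitive_on cp => t _; exact: dpsi.
move=> /(_ (lexx 0) ler01 (lexx 1)).
have -> : psi 1 = psi 0 by rewrite -(per_psi 0) add0r.
rewrite subrr RintegralB//; last 2 first.
- by apply: within_continuous_integrable; exact: within_continuous_peak.
- by apply: within_continuous_integrable; apply: continuous_subspaceT; exact: cst_continuous.
rewrite Rintegral_cst//= lebesgue_measure_itv/= lte_fin ltr01 sube0/= mulr1.
by move/esym/eqP; rewrite subr_eq0 => /eqP.
Qed.

(* With [q < q'] the values of [cos^2] at [pi d] and [pi d / 2], the peak is at most [q ^+ n] at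
   distance [d] from [a] while its integral is at least [d * q' ^+ n]. *)
Lemma peak_concentrates w a e : {within `[0, 1], continuous w} ->
  0 < a < 1 -> 0 < e -> exists N, forall n, (N <= n)%N ->
  0 < \int[mu]_(t in `[0, 1]) peak a n t /\
  `|\int[mu]_(t in `[0, 1]) (w t * peak a n t) -
    w a * \int[mu]_(t in `[0, 1]) peak a n t|
    <= e * \int[mu]_(t in `[0, 1]) peak a n t.
Proof.
move=> cw /andP[a0 a1] e0.
have a01 : 0 <= a <= 1 by rewrite !ltW.
have [M M0 wM] := within_continuous_bounded cw.
have e2 : 0 < e / 2 by rewrite divr_gt0.
have [d' d'0 d'P] := (within_continuousP 0 1 w).1 cw a _ a01 e2.
(* The bounds by [a] and [1 - a] keep the peak inside the period and give [|t - a| <= 1 - d] on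
   [[0, 1]], away from the translates of the peak. *)
pose d := Num.min d' (Num.min a (1 - a)).
have d0 : 0 < d by rewrite !lt_min d'0 a0 subr_gt0.
have dd' : d <= d' by rewrite ge_min lexx.
have da : d <= a by rewrite !ge_min lexx/= orbT.
have da1 : d <= 1 - a by rewrite !ge_min lexx/= !orbT.
clearbody d; clear d'0.
have d2 : d <= 2^-1 by clear -da da1; lra.
pose q := cos (pi * d) ^+ 2; pose q' := cos (pi * (d / 2)) ^+ 2.
have [qq' q0] : q < q' /\ 0 <= q.
  split; last exact: sqr_ge0.
  have p0 := pi_gt0 R.
  have c0 : 0 <= cos (pi * d) by apply: cos_pi_ge0 => //; exact: ltW.
  have m1 : pi * d \in `[0, pi]%R.
    rewrite in_itv/= mulr_ge0 ?(ltW p0) ?(ltW d0)//= ler_piMr ?(ltW p0)//.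
    by clear -d2; lra.
  have m2 : pi * (d / 2) \in `[0, pi]%R.
    rewrite in_itv/= mulr_ge0 ?(ltW p0) ?divr_ge0 ?(ltW d0)//= ler_piMr ?(ltW p0)//.
    by clear -d2 d0; lra.
  have cc : cos (pi * d) < cos (pi * (d / 2)).
    by rewrite ltr_cos// ltr_pM2l//; clear -d0; lra.
  by rewrite /q /q' ltrXn2r// ?nnegrE//.
have q'0 : 0 < q' by exact: le_lt_trans qq'.
have : (q / q') ^+ n @[n --> \oo] --> (0 : R).
  by apply: cvg_expr; rewrite ger0_norm ?divr_ge0 ?(ltW q'0)// ltr_pdivrMr ?mul1r.
(* Chosen so that the far part, at most [2 * M * q ^+ n], is below [e / 2] times the lower bound
   [d * q' ^+ n] of the integral. *)
have e'0 : 0 < e / 2 * d / (2 * M).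
  by rewrite divr_gt0 ?mulr_gt0.
move=> /cvgrPdist_lt /(_ _ e'0) [N _ NP]; exists N => n Nn.
have {}NP : (q / q') ^+ n < e / 2 * d / (2 * M).
  by have := NP n Nn; rewrite /= sub0r normrN ger0_norm// exprn_ge0// divr_ge0// ltW.
have {NP} tail : 2 * M * q ^+ n <= e / 2 * (d * q' ^+ n).
  have qn0 : 0 < q' ^+ n by rewrite exprn_gt0.
  have M2 : 0 < 2 * M by rewrite mulr_gt0.
  have -> : q ^+ n = (q / q') ^+ n * q' ^+ n by rewrite expr_div_n divfK// gt_eqF.
  by rewrite !mulrA ler_wpM2r ?(ltW qn0)// mulrC -ler_pdivlMr// ltW.
have pc x y : {within `[x, y], continuous (peak a n)}.
  exact: within_continuous_peak.
have pint x y := within_continuous_integrable (pc x y).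
have cint x y (k : R) : mu.-integrable `[x, y] (EFin \o (fun=> k)).
  by apply: within_continuous_integrable; apply: continuous_subspaceT; exact: cst_continuous.
set K := \int[mu]_(t in `[0, 1]) peak a n t.
have ge0 x y : 0 <= \int[mu]_(t in `[x, y]) peak a n t.
  by apply: Rintegral_ge0 => t _; exact: peak_ge0.
have KE : d * q' ^+ n <= K.
  have h1 : 0 <= a - d / 2 by clear -da d0; lra.
  have h2 : a - d / 2 <= a + d / 2 by clear -d0; lra.
  have h3 : a + d / 2 <= 1 by clear -da1 d0; lra.
  rewrite /K (Rintegral_itv_cat (lexx 0) h1 (le_trans h2 h3) (lexx 1))//.
  rewrite (Rintegral_itv_cat h1 h2 h3 (lexx 1))//.
  rewrite (@le_trans _ _ (\int[mu]_(t in `[a - d / 2, a + d / 2]) peak a n t))//.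
    rewrite (@le_trans _ _ (\int[mu]_(t in `[a - d / 2, a + d / 2]) (q' ^+ n)))//.
      rewrite Rintegral_cst//= lebesgue_measure_itv/= lte_fin.
      have -> : a - d / 2 < a + d / 2 by clear -d0; lra.
      rewrite -EFinB /=.
      have -> : a + d / 2 - (a - d / 2) = d by clear; field.
      by rewrite mulrC.
    apply: le_Rintegral => // t /=.
    rewrite in_itv/= => /andP[t1 t2].
    apply: peak_ge; last by clear -d0 d2; lra.
    by rewrite ler_distl; clear -t1 t2; apply/andP; split; lra.
  by rewrite addrCA lerDl addr_ge0.
have dq0 : 0 < d * q' ^+ n by exact: mulr_gt0 d0 (exprn_gt0 n q'0).
have K0 : 0 < K := lt_le_trans dq0 KE.
split => //.
have wpi : mu.-integrable `[0, 1] (EFin \o (fun t => w t * peak a n t)).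
  exact: integrable_continuousM.
have wapi : mu.-integrable `[0, 1] (EFin \o (fun t => w a * peak a n t)).
  by apply: integrable_continuousM => //; apply: continuous_subspaceT; exact: cst_continuous.
rewrite /K -RintegralZl// -/K -RintegralB//.
have di := integrable_EFinB wpi wapi.
apply: (le_trans (le_normr_Rintegral _ di)) => //.
apply: (@le_trans _ _ (\int[mu]_(t in `[0, 1]) (e / 2 * peak a n t + 2 * M * q ^+ n))).
  have epi : mu.-integrable `[0, 1] (EFin \o (fun t => e / 2 * peak a n t)).
    by apply: integrable_continuousM => //; apply: continuous_subspaceT; exact: cst_continuous.
  apply: le_Rintegral => //.
  - exact: integrable_norm.
  - exact: integrable_EFinD.
  move=> t /=; rewrite in_itv/= => t01.
  rewrite -mulrBl normrM (ger0_norm (peak_ge0 a n t)).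
  have [td|dt] := ltP `|t - a| d.
    rewrite -[leLHS]addr0; apply: lerD; last first.
      by apply: mulr_ge0; [apply: mulr_ge0; rewrite // ltW|exact: exprn_ge0].
    apply: ler_wpM2r; first exact: peak_ge0.
    by apply/ltW/d'P => //; exact: lt_le_trans dd'.
  rewrite -[leLHS]add0r; apply: lerD.
    by apply: mulr_ge0; [rewrite ltW|exact: peak_ge0].
  apply: ler_pM => //; first exact: peak_ge0.
    rewrite mulr2n mulrDl mul1r (le_trans (ler_normB _ _))//.
    by rewrite lerD// wM.
  apply: peak_le => //; first exact: ltW.
  by rewrite ler_distl; move: t01 => /andP[t0 t1]; clear -t0 t1 da da1; apply/andP; split; lra.
have epi : mu.-integrable `[0, 1] (EFin \o (fun t => e / 2 * peak a n t)).
  by apply: integrable_continuousM => //; apply: continuous_subspaceT; exact: cst_continuous.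
rewrite RintegralD//.
rewrite RintegralZl// -/K Rintegral_cst//= lebesgue_measure_itv/= lte_fin ltr01 sube0/= mulr1.
rewrite [e in leRHS]splitr [leRHS]mulrDl lerD2l; apply: (le_trans tail).
by rewrite ler_pM2l.
Qed.

Lemma within_continuous_primitive a b f : a <= b -> mu.-integrable `[a, b] (EFin \o f) ->
  primitive_on a b (fun t => \int[mu]_(r in `[a, t]) f r) f.
Proof.
move=> ab fi; split => //; first exact: parameterized_integral_continuous.
by move=> x y ax xy yb; rewrite (Rintegral_subB ax xy yb fi).
Qed.

(** Transfers estimates to the ends of an interval: peaks are centred at interior points only, and
    the completed square is available only away from the poles of the cotangent. *)
Lemma nondecreasing_oo_cc a b F : a < b -> {within `[a, b], continuous F} ->
  (forall x y, a < x -> x <= y -> y < b -> F x <= F y) -> F a <= F b.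
Proof.
move=> ab /within_continuousP cF ndF.
rewrite leNgt; apply/negP => ba.
pose e := (F a - F b) / 2.
have e0 : 0 < e by rewrite divr_gt0// subr_gt0.
have aab : a <= a <= b by rewrite lexx ltW.
have bab : a <= b <= b by rewrite lexx ltW.
have [d1 d10 d1P] := cF a e aab e0.
have [d2 d20 d2P] := cF b e bab e0.
pose r := Num.min (Num.min d1 d2) (b - a).
have r0 : 0 < r by rewrite !lt_min d10 d20 subr_gt0.
have rd1 : r <= d1 by rewrite !ge_min lexx.
have rd2 : r <= d2 by rewrite !ge_min lexx orbT.
have rba : r <= b - a by rewrite !ge_min lexx !orbT.
clearbody r.
have h1 : `|F (a + r / 2) - F a| < e.
  by apply: d1P; rewrite ?ltr_distl; clear -r0 rd1 rba; apply/andP; split; lra.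
have h2 : `|F (b - r / 2) - F b| < e.
  by apply: d2P; rewrite ?ltr_distl; clear -r0 rd2 rba; apply/andP; split; lra.
have : F (a + r / 2) <= F (b - r / 2) by apply: ndF; clear -r0 rba; lra.
move: h1 h2; rewrite !ltr_distl /e; clear => /andP[h1 _] /andP[_ h2] h.
lra.
Qed.

(* Since peaks with the same exponent have the same mean, the difference of two of them is
   the derivative of a test function, and thus is orthogonal to [v] minus a primitive of [g]. *)
Lemma weak_derivative_primitive v g : {within `[0, 1], continuous v} ->
  mu.-integrable `[0, 1] (EFin \o g) -> is_weak_derivative v g ->
  primitive_on 0 1 v g.
Proof.
move=> cv gi wd.
pose G t := \int[mu]_(r in `[0, t]) g r.
have pG : primitive_on 0 1 G g by exact: within_continuous_primitive.
have [cG _ Gg] := pG.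
have G0 : G 0 = 0 by rewrite /G set_itv1 Rintegral_set1.
have cint (h : R -> R) : {within `[0, 1], continuous h} ->
    mu.-integrable `[0, 1] (EFin \o h) by exact: within_continuous_integrable.
(* The constant 1 is a test function, so [g] has mean zero; integrating [G * psi'] by parts then
   leaves no boundary term. *)
have G1 : G 1 = 0.
  have := wd _ (@test_function_cst R 1); rewrite /circle_int.
  rewrite (_ : (fun t => v t * derive1 (fun=> 1 : R) (t : R)) = (fun=> 0)); last first.
    by apply/funext => t; rewrite derive1_cst mulr0.
  rewrite (_ : (fun t => g t * 1) = g); last by apply/funext => t; rewrite mulr1.
  rewrite Rintegral_cst//= mul0r => /esym/eqP.
  by rewrite oppr_eq0 => /eqP.
pose w t := v t - G t.
have cw : {within `[0, 1], continuous w}.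
  by move=> t; apply: continuousB; [exact: cv|exact: cG].
have orth psi chi : test_function psi ->
    (forall t, is_derive t (1 : R) psi (chi t)) ->
    {within `[0, 1], continuous chi} ->
    \int[mu]_(t in `[0, 1]) (w t * chi t) = 0.
  move=> tpsi dpsi cchi.
  have := wd _ tpsi; rewrite /circle_int (derive1_fun dpsi).
  have ppsi : primitive_on 0 1 psi chi.
    by apply: continuous_primitive_on cchi => t _.
  have [cpsi _ _] := ppsi.
  have [_ _ /(_ 0 1 (lexx 0) ler01 (lexx 1))] := primitive_onM pG ppsi.
  rewrite G0 G1 !mul0r subrr RintegralD//; last 2 first.
  - by apply: integrable_continuousM.
  - by apply: cint; exact: within_continuousM.
  move=> /esym/eqP; rewrite addr_eq0 => /eqP h1 h2.
  rewrite (_ : (fun t => w t * chi t) = (fun t => v t * chi t - G t * chi t)).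
    rewrite RintegralB//; last 2 first.
    - by apply: cint; exact: within_continuousM.
    - by apply: cint; exact: within_continuousM.
    rewrite h2; apply/eqP; rewrite subr_eq0 -[eqbRHS]opprK -h1.
    by apply/eqP; congr (- _); apply: eq_Rintegral => t _; rewrite mulrC.
  by apply/funext => t; rewrite /w mulrBl.
have weq x y : 0 < x < 1 -> 0 < y < 1 -> w x = w y.
  move=> x01 y01; apply/eqP; rewrite -subr_eq0 -normr_le0.
  apply/ler_addgt0Pr => e e0; rewrite add0r.
  have e2 : 0 < e / 2 by rewrite divr_gt0.
  have [N1 N1P] := peak_concentrates cw x01 e2.
  have [N2 N2P] := peak_concentrates cw y01 e2.
  have [K0 h1] := N1P (maxn N1 N2) (leq_maxl _ _).
  have [_ h2] := N2P (maxn N1 N2) (leq_maxr _ _).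
  move: K0 h1 h2; set n := maxn N1 N2.
  have [m mE] := Rintegral_peak n; rewrite !mE => m0 h1 h2.
  have [m' m'P] := @peak_primitive R n.
  have [p1 tp1 dp1] := m'P x; have [p2 tp2 dp2] := m'P y.
  have dp t : is_derive t (1 : R) (fun t => p1 t - p2 t) (peak x n t - peak y n t).
    by have d1 := dp1 t; have d2 := dp2 t; derive1; ring.
  have cp : {within `[0, 1], continuous (fun t => peak x n t - peak y n t)}.
    by move=> t; apply: continuousB; exact: within_continuous_peak.
  have := orth _ _ (test_functionB tp1 tp2) dp cp.
  rewrite (_ : (fun t => w t * (peak x n t - peak y n t)) =
    (fun t => w t * peak x n t - w t * peak y n t)); last first.
    by apply/funext => t; rewrite mulrBr.
  rewrite RintegralB//; last 2 first.
  - by apply: cint; apply: within_continuousM => //; exact: within_continuous_peak.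
  - by apply: cint; apply: within_continuousM => //; exact: within_continuous_peak.
  move=> /eqP; rewrite subr_eq0 => /eqP h3; rewrite h3 in h1.
  rewrite -(ler_pM2r m0) -[m in leLHS](gtr0_norm m0) -normrM.
  set I := \int[mu]_(t in _) _ in h1 h2.
  (* [w x * m] and [w y * m] are both within [e / 2 * m] of [I]: orthogonality to the difference of
     the peaks makes the two integrals equal. *)
  have -> : (w x - w y) * m = (I - w y * m) - (I - w x * m) by ring.
  rewrite (le_trans (ler_normB _ _))// [e in leRHS]splitr [leRHS]mulrDl.
  exact: lerD.
have wcst x : 0 <= x -> x <= 1 -> w x = w 2^-1.
  have l0 : (0 : R) < 2^-1 by rewrite invr_gt0.
  have l1 : 2^-1 < (1 : R) by rewrite invf_lt1// ltr1n.
  have we : w 0 = w 2^-1 /\ w 1 = w 2^-1.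
    have cwl : {within `[0, 2^-1], continuous w}.
      by apply: continuous_subspaceW cw; apply: subset_itv; rewrite bnd_simp// ltW.
    have cwr : {within `[2^-1, 1], continuous w}.
      by apply: continuous_subspaceW cw; apply: subset_itv; rewrite bnd_simp// ltW.
    have cN a b : {within `[a, b], continuous w} -> {within `[a, b], continuous (fun t => - w t)}.
      by move=> c t; apply: continuousN; exact: c.
    have wl y z : 0 < y -> y <= z -> z < 2^-1 -> w y = w z.
      by move=> y0 yz z2; apply: weq; clear -y0 yz z2; apply/andP; split; lra.
    have wr y z : 2^-1 < y -> y <= z -> z < 1 -> w y = w z.
      by move=> y0 yz z2; apply: weq; clear -y0 yz z2; apply/andP; split; lra.
    split; apply/eqP; rewrite eq_le; apply/andP; split.
    + by apply: (nondecreasing_oo_cc l0 cwl) => y z y0 yz z2; rewrite (wl y z).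
    + rewrite -lerN2; apply: (nondecreasing_oo_cc l0 (cN _ _ cwl)) => y z y0 yz z2.
      by rewrite (wl y z).
    + rewrite -lerN2; apply: (nondecreasing_oo_cc l1 (cN _ _ cwr)) => y z y0 yz z2.
      by rewrite (wr y z).
    + by apply: (nondecreasing_oo_cc l1 cwr) => y z y0 yz z2; rewrite (wr y z).
  case: we => we0 we1; rewrite le_eqVlt => /predU1P[<-//|x0].
  rewrite le_eqVlt => /predU1P[->//|x1].
  by apply: weq; rewrite ?l0 ?x0.
split => // x y x0 xy y1.
rewrite -Gg//.
have wx := wcst x x0 (le_trans xy y1); have wy := wcst y (le_trans x0 xy) y1.
have : w y - w x = 0 by rewrite wx wy subrr.
by rewrite /w => h; apply/eqP; rewrite -subr_eq0 -h; apply/eqP; ring.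
Qed.

End WeakDerivative.

(** * Completing the square *)

Section RegularizedQuotient.
Context {R : realType}.
Implicit Types (F G : R -> R) (t f g e : R).

Lemma is_derive1_linear_approx F t f e : is_derive t (1 : R) F f -> 0 < e ->
  exists2 d : R, 0 < d & forall s : R, `|s - t| < d ->
    `|F s - F t - f * (s - t)| <= e * `|s - t|.
Proof.
move=> [dF vF] e0.
have cF : (fun h : R => h^-1 *: (F (h *: (1 : R) + t) - F t)) @ 0^' --> f.
  by rewrite -vF; exact: dF.
move/cvgrPdist_le: cF => /(_ e e0); rewrite near_withinE => -[d /= d0 dP].
exists d => // s std; have [->|st] := eqVneq s t.
  by rewrite !subrr mulr0 subrr normr0 mulr0.
have st0 : s - t != 0 by rewrite subr_eq0.
have := dP (s - t); rewrite /= sub0r normrN => /(_ std st0).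
rewrite /GRing.scale/= mulr1 subrK => h.
have -> : F s - F t - f * (s - t) = - (f - (s - t)^-1 * (F s - F t)) * (s - t).
  by field.
by rewrite normrM normrN ler_wpM2r.
Qed.

(** A double zero over a simple one: [|F s| <= A * |s - t|] and [|G s| >= |g| / 2 * |s - t|] near
    [t], so the quotient is of order [|s - t|]. Its limit 0 is also the value at [t], where the
    division is by zero. *)
Lemma continuous_sqr_div F G t f g : is_derive t (1 : R) F f ->
  is_derive t (1 : R) G g -> F t = 0 -> G t = 0 -> g != 0 ->
  {for t, continuous (fun s => F s ^+ 2 / G s)}.
Proof.
move=> dF dG Ft Gt g0.
have g2 : 0 < `|g| / 2 by rewrite divr_gt0// normr_gt0.
have [d1 d10 d1P] := is_derive1_linear_approx dF ltr01.
have [d2 d20 d2P] := is_derive1_linear_approx dG g2.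
pose A := `|f| + 1.
have A0 : 0 < A by rewrite ltr_wpDl.
pose c := `|g| / 2.
have c0 : 0 < c by [].
apply/cvgrPdist_le => e e0.
pose r := Num.min (Num.min d1 d2) (e * c / A ^+ 2).
have r0 : 0 < r by rewrite !lt_min d10 d20/=; apply: divr_gt0; [exact: mulr_gt0|exact: exprn_gt0].
have rd1 : r <= d1 by rewrite !ge_min lexx.
have rd2 : r <= d2 by rewrite !ge_min lexx orbT.
have re : r <= e * c / A ^+ 2 by rewrite !ge_min lexx !orbT.
exists r => //= s str; have {}str : `|s - t| < r by rewrite distrC.
rewrite Ft expr0n/= mul0r sub0r normrN.
have [->|st] := eqVneq s t; first by rewrite Ft expr0n/= mul0r normr0 ltW.
have st0 : 0 < `|s - t| by rewrite normr_gt0 subr_eq0.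
have hF : `|F s| <= A * `|s - t|.
  have := d1P s (lt_le_trans str rd1); rewrite Ft subr0 mul1r => h.
  have -> : F s = F s - f * (s - t) + f * (s - t) by ring.
  rewrite (le_trans (ler_normD _ _))// normrM /A mulrDl mul1r addrC.
  by rewrite lerD2l.
have hG : c * `|s - t| <= `|G s|.
  have := d2P s (lt_le_trans str rd2); rewrite Gt subr0 -/c => h.
  have := lerB_normD (g * (s - t)) (G s - g * (s - t)).
  rewrite [X in _ <= `|X|](_ : _ = G s) 1?normrM => [h'|]; last by ring.
  rewrite (le_trans _ h')//.
  have -> : c * `|s - t| = `|g| * `|s - t| - c * `|s - t| by rewrite /c; field.
  by rewrite lerD2l lerN2.
clearbody c.
have G0 : 0 < `|G s| by apply: lt_le_trans hG; rewrite mulr_gt0.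
rewrite normrM normfV normrX ler_pdivrMr//.
apply: (@le_trans _ _ (A ^+ 2 * `|s - t| ^+ 2)).
  by rewrite -exprMn lerXn2r ?nnegrE// mulr_ge0 ?ltW.
apply: (@le_trans _ _ (e * (c * `|s - t|))); last by rewrite ler_wpM2l// ltW.
rewrite [`|s - t| ^+ 2]expr2 !mulrA ler_wpM2r ?(ltW st0)//.
rewrite mulrC -ler_pdivlMr ?exprn_gt0//.
by apply/ltW; exact: lt_le_trans re.
Qed.

End RegularizedQuotient.

Section CompletingTheSquare.
Context {R : realType}.
Notation mu := (@lebesgue_measure R).
Variables (phi f g : R -> R).
Hypotheses (dphi : forall t : R, is_derive t (1 : R) phi (f t))
  (cf : continuous f) (f_gt0 : forall t, 0 < f t)
  (phiD1 : forall t, phi (t + 1) = phi t + 1)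
  (pf : primitive_on 0 1 f (fun t => f t * g t))
  (gi : mu.-integrable `[0, 1] (EFin \o g))
  (g2i : mu.-integrable `[0, 1] (EFin \o (fun t => g t ^+ 2))).
Implicit Types (r p t x y : R).

Definition sn r t : R := sin (pi * (t - r)).
Definition cs r t : R := cos (pi * (t - r)).
Definition sn_phi p t : R := sin (pi * (phi t - p)).
Definition cs_phi p t : R := cos (pi * (phi t - p)).

(** For the component [y = sqrt f * sn r] this is [((dy/ds)^2 - pi^2 y^2) * f], the integrand of
    Wirtinger's inequality in [s = phi t], transported to [t]; the roots of [f] cancel. *)
Definition deficit r t : R :=
  (g t / 2 * sn r t + pi * cs r t) ^+ 2 - pi ^+ 2 * f t ^+ 2 * sn r t ^+ 2.
(** [sqrt f] times [dy/ds - pi * cot (pi (s - p)) * y], which vanishes when [y] is a multiple of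
    [sin (pi (s - p))], the extremal of Wirtinger's inequality. *)
Definition defect_root r p t : R :=
  g t / 2 * sn r t + pi * cs r t - pi * f t * cs_phi p t * sn r t / sn_phi p t.
(* Vanishes where [sn_phi p] does, because [x / 0 = 0]; this is also its limit there. *)
Definition boundary r p t : R :=
  pi * f t * (sn r t ^+ 2 * cs_phi p t / sn_phi p t).

Lemma is_derive_sn r t : is_derive t (1 : R) (sn r) (pi * cs r t).
Proof. by rewrite /sn /cs; derive1; ring. Qed.

Lemma is_derive_cs r t : is_derive t (1 : R) (cs r) (- pi * sn r t).
Proof. by rewrite /sn /cs; derive1; ring. Qed.

Lemma is_derive_sn_phi p t :
  is_derive t (1 : R) (sn_phi p) (pi * f t * cs_phi p t).
Proof. by have d := dphi t; rewrite /sn_phi /cs_phi; derive1; ring. Qed.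

Lemma is_derive_cs_phi p t :
  is_derive t (1 : R) (cs_phi p) (- pi * f t * sn_phi p t).
Proof. by have d := dphi t; rewrite /sn_phi /cs_phi; derive1; ring. Qed.

Lemma sn_phi2 p t : sn_phi p t ^+ 2 = 1 - cs_phi p t ^+ 2.
Proof. exact: sin2cos2. Qed.

Lemma is_derive_continuous F (d : R -> R) :
  (forall t, is_derive t (1 : R) F (d t)) -> continuous F.
Proof.
move=> dF t; apply: differentiable_continuous; apply/derivable1_diffP.
by have [] := dF t.
Qed.

Lemma continuous_sn r : continuous (sn r).
Proof. exact: is_derive_continuous (is_derive_sn r). Qed.
Lemma continuous_cs r : continuous (cs r).
Proof. exact: is_derive_continuous (is_derive_cs r). Qed.
Lemma continuous_sn_phi p : continuous (sn_phi p).
Proof. exact: is_derive_continuous (is_derive_sn_phi p). Qed.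
Lemma continuous_cs_phi p : continuous (cs_phi p).
Proof. exact: is_derive_continuous (is_derive_cs_phi p). Qed.

Lemma continuous_within (h : R -> R) x y : continuous h ->
  {within `[x, y], continuous h}.
Proof. exact: continuous_subspaceT. Qed.

Lemma integrable_deficit r : mu.-integrable `[0, 1] (EFin \o deficit r).
Proof.
have cM (a b : R -> R) : continuous a -> continuous b -> continuous (fun t => a t * b t).
  by move=> ca cb t; apply: continuousM; [exact: ca|exact: cb].
have cB (a b : R -> R) : continuous a -> continuous b -> continuous (fun t => a t - b t).
  by move=> ca cb t; apply: continuousB; [exact: ca|exact: cb].
have cc (k : R) : continuous (fun _ : R => k) by exact: cst_continuous.
have cS := @continuous_sn r; have cC := @continuous_cs r.
have -> : deficit r = (fun t => (4^-1 * (sn r t * sn r t)) * g t ^+ 2 +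
    ((pi * (sn r t * cs r t)) * g t +
     (pi ^+ 2 * (cs r t * cs r t - (f t * f t) * (sn r t * sn r t))))).
  by apply/funext => t; rewrite /deficit; field.
apply: integrable_EFinD.
  apply: integrable_continuousM => //; apply: continuous_within.
  by apply: (cM) => //; exact: cM.
apply: integrable_EFinD.
  apply: integrable_continuousM => //; apply: continuous_within.
  by apply: (cM) => //; exact: cM.
apply: within_continuous_integrable; apply: continuous_within.
apply: (cM) => //; apply: (cB); first exact: cM.
by apply: (cM); exact: (cM).
Qed.

(** Since [cot (pi (s - p))] has derivative [- pi (1 + cot^2)], one has in the variable [s] that
    [y'^2 - pi^2 y^2 = (y' - pi cot y)^2 + (pi cot y^2)']. The exact term [boundary] is [f * W] with
    [W] continuously differentiable on [[x, y]], so the product rule for primitives applies. *)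
Lemma completing_the_square r p x y : 0 <= x -> x <= y -> y <= 1 ->
  (forall t, x <= t <= y -> sn_phi p t != 0) ->
  mu.-integrable `[x, y] (EFin \o (fun t => defect_root r p t ^+ 2)) /\
  (\int[mu]_(t in `[x, y]) deficit r t) - (boundary r p y - boundary r p x) =
  \int[mu]_(t in `[x, y]) (defect_root r p t ^+ 2).
Proof.
move=> x0 xy y1 s0.
pose W t := pi * (sn r t ^+ 2 * (cs_phi p t / sn_phi p t)).
pose w t := pi * (2 * pi * (sn r t * cs r t) * (cs_phi p t / sn_phi p t) -
   pi * f t * sn r t ^+ 2 / sn_phi p t ^+ 2).
have dW t : x <= t <= y -> is_derive t (1 : R) W (w t).
  move=> /s0 st; rewrite /W.
  have d1 := is_derive_sn r t; have d2 := is_derive_sn_phi p t.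
  have d3 := is_derive_cs_phi p t.
  derive1; have := sn_phi2 p t; rewrite /w.
  move: (sn r t) (cs r t) (f t) (cs_phi p t) (sn_phi p t) (pi : R) st => S C F k s P st.
  rewrite !expr2 => s2; transitivity (P * (2 * P * (S * C) * (k / s) -
    P * F * (S * S) * (s * s + k * k) / (s * s))); first by field.
  have -> : s * s + k * k = 1 by rewrite s2; ring.
  by rewrite mulr1.
have cq (a b : R -> R) t : {for t, continuous a} -> {for t, continuous b} ->
    b t != 0 -> {for t, continuous (fun t => a t / b t)}.
  by move=> ca cb bt; apply: continuousM => //; exact: continuousV.
have cM (a b : R -> R) t : {for t, continuous a} -> {for t, continuous b} ->
    {for t, continuous (fun t => a t * b t)}.
  by move=> ca cb; apply: continuousM.
have cB (a b : R -> R) t : {for t, continuous a} -> {for t, continuous b} ->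
    {for t, continuous (fun t => a t - b t)}.
  by move=> ca cb; apply: continuousB.
have cc (k : R) : continuous (fun _ : R => k) by exact: cst_continuous.
have cS := @continuous_sn r; have cC := @continuous_cs r.
have cs' := @continuous_sn_phi p; have ck := @continuous_cs_phi p.
have cw : {within `[x, y], continuous w}.
  apply: continuous_in_subspaceT => t; rewrite inE/= in_itv/= => /s0 st.
  pose w1 t := 2 * pi * (sn r t * cs r t).
  pose w2 t := pi * f t * (sn r t * sn r t).
  have c1 : {for t, continuous w1}.
    by refine (cM (fun=> 2 * pi) _ t (cc _ _) (cM _ _ t (cS _) (cC _))).
  have c2 : {for t, continuous w2}.
    by refine (cM _ _ t (cM (fun=> pi) f t (cc _ _) (@cf t)) (cM _ _ t (cS _) (cS _))).
  have c3 := cq _ _ t (ck t) (cs' t) st.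
  have c4 := cq _ _ t c2 (cM _ _ t (cs' t) (cs' t)) (mulf_neq0 st st).
  exact (cM (fun=> pi) _ t (cc _ _) (cB _ _ t (cM _ _ t c1 c3) c4)).
have pW : primitive_on x y W w by exact: continuous_primitive_on.
have pB := primitive_onM (primitive_on_sub x0 y1 pf) pW.
have [_ Bi /(_ x y (lexx x) xy (lexx y))] := pB.
have BE t : boundary r p t = f t * W t by rewrite /boundary /W; ring.
rewrite -!BE => ->; have Di := integrable_sub_itv x0 y1 (integrable_deficit r).
suff E t : x <= t <= y ->
    deficit r t - (W t * (f t * g t) + f t * w t) = defect_root r p t ^+ 2.
  split.
    apply: eq_integrable (integrable_EFinB Di Bi) => // t.
    by rewrite inE/= in_itv/= => /E ->.
  rewrite -RintegralB//; apply: eq_Rintegral => t.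
  by rewrite inE/= in_itv/= => /E.
move=> /s0 st; rewrite /deficit /defect_root /W /w.
move: (sn_phi2 p t) st.
move: (sn r t) (cs r t) (f t) (cs_phi p t) (sn_phi p t) (pi : R) (g t).
move=> S C F k s P u; rewrite !expr2 => s2 st.
apply/eqP; rewrite -subr_eq0; apply/eqP.
transitivity (P * P * F * F * S * S * (1 - k * k - s * s) / (s * s)).
  by field.
by rewrite s2 subrr mulr0 mul0r.
Qed.

(** A zero of [sn_phi p] is simple, as [cs_phi p] cannot vanish with it; a common zero of [sn r] is
    doubled by the square in the numerator. *)
Lemma continuous_boundary r p t : (sn_phi p t = 0 -> sn r t = 0) ->
  {for t, continuous (boundary r p)}.
Proof.
move=> s0.
have cM (a b : R -> R) : {for t, continuous a} -> {for t, continuous b} ->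
    {for t, continuous (fun t => a t * b t)}.
  by move=> ca cb; apply: continuousM.
have cS := @continuous_sn r; have ck := @continuous_cs_phi p.
have -> : boundary r p = (fun t => (pi * f t) *
    (cs_phi p t * (sn r t ^+ 2 / sn_phi p t))).
  by apply/funext => u; rewrite /boundary; ring.
refine (cM _ _ (cM (fun=> pi) f (@cst_continuous _ _ pi t) (@cf t)) (cM _ _ (ck t) _)).
have [st|st] := eqVneq (sn_phi p t) 0; last first.
  refine (cM (fun t => sn r t * sn r t) _ (cM _ _ (cS t) (cS t)) _).
  by apply: continuousV => //; exact: continuous_sn_phi.
apply: (continuous_sqr_div (is_derive_sn r t) (is_derive_sn_phi p t)) => //.
  exact: s0.
have k0 : cs_phi p t != 0.
  apply/eqP => k0; have := sn_phi2 p t.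
  by rewrite st k0 !expr0n/= subr0 => /esym/eqP; rewrite oner_eq0.
by rewrite mulf_neq0// mulf_neq0 ?gt_eqF ?pi_gt0.
Qed.

(** Inside the interval the increments of [M] are integrals of squares. Continuity of [boundary]
    carries the monotonicity of [M] to [x] and [y], the only possible poles. *)
Lemma integral_deficit_ge r p x y : 0 <= x -> x < y -> y <= 1 ->
  (forall t, x < t < y -> sn_phi p t != 0) ->
  (sn_phi p x = 0 -> sn r x = 0) -> (sn_phi p y = 0 -> sn r y = 0) ->
  forall u v, x <= u -> u <= v -> v <= y ->
  boundary r p v - boundary r p u <= \int[mu]_(t in `[u, v]) deficit r t.
Proof.
move=> x0 xy y1 s0 sx sy u v xu uv vy.
pose M t := (\int[mu]_(s in `[0, t]) deficit r s) - boundary r p t.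
have Di := integrable_deficit r.
have MB a b : x <= a -> a <= b -> b <= y -> M b - M a =
    (\int[mu]_(t in `[a, b]) deficit r t) - (boundary r p b - boundary r p a).
  move=> xa ab' b_y; rewrite /M.
  rewrite (Rintegral_subB (le_trans x0 xa) ab' (le_trans b_y y1) Di); ring.
suff : M u <= M v by rewrite -subr_ge0 MB// subr_ge0.
have cM : {within `[0, 1], continuous (fun t => \int[mu]_(s in `[0, t]) deficit r s)}.
  by have [] := within_continuous_primitive ler01 Di.
have cI : {within `[x, y], continuous (fun t => \int[mu]_(s in `[0, t]) deficit r s)}.
  by apply: continuous_subspaceW cM; apply: subset_itv; rewrite bnd_simp.
have cb : {within `[x, y], continuous (boundary r p)}.
  apply: continuous_in_subspaceT => t; rewrite inE/= in_itv/= => /andP[xt ty].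
  apply: continuous_boundary.
  move: xt; rewrite le_eqVlt => /predU1P[<-//|xt].
  move: ty; rewrite le_eqVlt => /predU1P[->//|ty].
  by move=> st; have := s0 t; rewrite xt ty st eqxx => /(_ isT).
move: uv; rewrite le_eqVlt => /predU1P[->//|uv].
apply: (@nondecreasing_oo_cc _ u v M uv).
  apply: (@continuous_subspaceW _ _ `[u, v] `[x, y]).
    by apply: subset_itv; rewrite bnd_simp.
  by move=> t; exact: (continuousB (cI t) (cb t)).
move=> a b ua ab' bv; rewrite -subr_ge0 MB//; last 2 first.
- by rewrite (le_trans xu)// ltW.
- by rewrite (le_trans (ltW bv)).
have [||||_ ->] := @completing_the_square r p a b.
- by rewrite (le_trans x0)// (le_trans xu)// ltW.
- by [].
- by rewrite (le_trans (ltW bv))// (le_trans vy).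
- move=> t /andP[at_ tb]; apply: s0.
  by rewrite (le_lt_trans xu) ?(lt_le_trans ua)//= (le_lt_trans tb)// (lt_le_trans bv).
by apply: Rintegral_ge0 => t _; exact: sqr_ge0.
Qed.

(** * Wirtinger's inequality for the two components *)

Lemma phi_lt x y : x < y -> phi x < phi y.
Proof.
move=> xy; have cphi : {within `[x, y], continuous phi}.
  by apply: continuous_within; exact: is_derive_continuous dphi.
have [c _ cE] := MVT xy (fun t _ => dphi t) cphi.
by rewrite -subr_gt0 cE mulr_gt0// subr_gt0.
Qed.

Lemma derivative_periodic t : f (t + 1) = f t.
Proof.
have d1 : is_derive t (1 : R) (fun s => phi (s + 1)) (f (t + 1)).
  have := @is_derive1_comp _ phi (fun s => s + 1) t _ _ (dphi (t + 1))
    (is_derive1_add (is_derive1_id t) (is_derive1_const t 1)).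
  by rewrite addr0 mulr1.
have d2 : is_derive t (1 : R) (fun s => phi s + 1) (f t).
  have := is_derive1_add (dphi t) (is_derive1_const t 1).
  by rewrite addr0.
have e : (fun s => phi (s + 1)) = (fun s => phi s + 1) by apply/funext.
by rewrite e in d1; rewrite -[LHS](@derive_val _ _ _ _ _ _ _ d1) (@derive_val _ _ _ _ _ _ _ d2).
Qed.

Lemma sn_phi_gt0 p t : p < phi t -> phi t < p + 1 -> 0 < sn_phi p t.
Proof.
move=> h1 h2; have p0 := pi_gt0 R; apply: sin_gt0_pi; apply/andP; split.
  by rewrite mulr_gt0// subr_gt0.
by rewrite gtr_pMr// ltrBlDl.
Qed.

Lemma sn_phi_lt0 p t : p < phi t + 1 -> phi t < p -> sn_phi p t < 0.
Proof.
move=> h1 h2; have p0 := pi_gt0 R.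
rewrite /sn_phi -oppr_gt0 -sinN -mulrN opprB; apply: sin_gt0_pi; apply/andP; split.
  by rewrite mulr_gt0// subr_gt0.
by rewrite gtr_pMr// ltrBlDl.
Qed.

Lemma sn_self r : sn r r = 0.
Proof. by rewrite /sn subrr mulr0 sin0. Qed.

Lemma sn01 : sn 0 1 = 0.
Proof. by rewrite /sn subr0 mulr1 sinpi. Qed.

Lemma phi1 : phi 1 = phi 0 + 1.
Proof. by rewrite -phiD1 add0r. Qed.

Lemma sn_phi0_gt0 t : 0 < t < 1 -> 0 < sn_phi (phi 0) t.
Proof.
move=> /andP[t0 t1]; apply: sn_phi_gt0; first exact: phi_lt.
by rewrite -phi1; exact: phi_lt.
Qed.

Lemma boundary_sn0 r p t : sn r t = 0 -> boundary r p t = 0.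
Proof. by move=> st; rewrite /boundary st expr0n/= !mul0r mulr0. Qed.

(** Stated on every subinterval because the equality case localizes it. *)
Lemma integral_deficit0_ge x y : 0 <= x -> x <= y -> y <= 1 ->
  boundary 0 (phi 0) y - boundary 0 (phi 0) x <= \int[mu]_(t in `[x, y]) deficit 0 t.
Proof.
move=> x0 xy y1; apply: (@integral_deficit_ge 0 (phi 0) 0 1) => //.
- by move=> t /sn_phi0_gt0; rewrite lt0r => /andP[].
- by rewrite sn_self.
- by rewrite sn01.
Qed.

Lemma integral_deficit0_ge0 : 0 <= \int[mu]_(t in `[0, 1]) deficit 0 t.
Proof.
have := integral_deficit0_ge (lexx 0) ler01 (lexx 1).
by rewrite !boundary_sn0 ?subrr// ?sn_self// sn01.
Qed.

(** The pole is in the middle, hence one estimate on each half. The boundary term vanishes at [1/2]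
    and takes equal values at 0 and 1, where [sn], [cs_phi] and [sn_phi] all change sign and [f] is
    periodic. *)
Lemma integral_deficit_half_ge0 : 0 <= \int[mu]_(t in `[0, 1]) deficit 2^-1 t.
Proof.
have h0 : (0 : R) < 2^-1 by rewrite invr_gt0.
have h1 : 2^-1 < (1 : R) by rewrite invf_lt1// ltr1n.
set p := phi 2^-1.
have p0 : phi 0 < p by exact: phi_lt.
have p1 : p < phi 0 + 1 by rewrite -phi1; exact: phi_lt.
have s0 t : 0 <= t -> t < 2^-1 -> sn_phi p t < 0.
  move=> t0 t2; apply: sn_phi_lt0; last exact: phi_lt.
  apply: (lt_le_trans p1); rewrite lerD2r.
  by move: t0; rewrite le_eqVlt => /predU1P[->//|/phi_lt/ltW].
have s1 t : 2^-1 < t -> t <= 1 -> 0 < sn_phi p t.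
  move=> t2 t1; apply: sn_phi_gt0; first exact: phi_lt.
  apply: (@le_lt_trans _ _ (phi 1)); last by rewrite phi1 ltrD2r.
  by move: t1; rewrite le_eqVlt => /predU1P[->//|/phi_lt/ltW].
rewrite (Rintegral_itv_cat (lexx 0) (ltW h0) (ltW h1) (lexx 1) (integrable_deficit _)).
have l : boundary 2^-1 p 2^-1 - boundary 2^-1 p 0 <=
    \int[mu]_(t in `[0, 2^-1]) deficit 2^-1 t.
  apply: (@integral_deficit_ge _ p 0 2^-1) => //; try exact: ltW.
  - by move=> t /andP[t0 t2]; rewrite lt_eqF// s0// ltW.
  - by move=> e; move: (s0 0 (lexx 0) h0); rewrite e ltxx.
  - by rewrite sn_self.
have r : boundary 2^-1 p 1 - boundary 2^-1 p 2^-1 <=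
    \int[mu]_(t in `[2^-1, 1]) deficit 2^-1 t.
  apply: (@integral_deficit_ge _ p 2^-1 1) => //; try exact: ltW.
  - by move=> t /andP[t0 t2]; rewrite gt_eqF// s1// ltW.
  - by rewrite sn_self.
  - by move=> e; move: (s1 1 h1 (lexx 1)); rewrite e ltxx.
apply: le_trans (lerD l r).
rewrite (boundary_sn0 p (sn_self _)) sub0r subr0 addrC subr_ge0.
have -> : boundary 2^-1 p 1 = boundary 2^-1 p 0; last by [].
rewrite /boundary; have -> : f 1 = f 0 by rewrite -[1]add0r derivative_periodic.
have -> : cs_phi p 1 = - cs_phi p 0.
  by rewrite /cs_phi phi1 addrAC mulrDr mulr1 cosDpi.
have -> : sn_phi p 1 = - sn_phi p 0.
  by rewrite /sn_phi phi1 addrAC mulrDr mulr1 sinDpi.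
have -> : sn 2^-1 1 = - sn 2^-1 0.
  rewrite /sn; have -> : pi * (1 - 2^-1) = pi * (0 - 2^-1) + pi :> R by ring.
  by rewrite sinDpi.
by rewrite sqrrN mulrN invrN mulrNN.
Qed.

(** The two components are the sine and, up to sign, the cosine of [pi * t]: the cross terms in [g]
    cancel and the squares add up to 1. *)
Lemma deficit_sum t : deficit 0 t + deficit 2^-1 t =
  4^-1 * (g t ^+ 2 - 4 * pi ^+ 2 * f t ^+ 2) + pi ^+ 2.
Proof.
rewrite /deficit.
have -> : sn 2^-1 t = - cs 0 t.
  by rewrite /sn /cs subr0 mulrBr sinBpihalf.
have -> : cs 2^-1 t = sn 0 t.
  by rewrite /sn /cs subr0 mulrBr cosBpihalf.
have : sn 0 t ^+ 2 = 1 - cs 0 t ^+ 2 by exact: sin2cos2.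
move: (sn 0 t) (cs 0 t) (pi : R) => S C P s2.
transitivity ((S ^+ 2 + C ^+ 2) * (4^-1 * (g t ^+ 2 - 4 * P ^+ 2 * f t ^+ 2) + P ^+ 2)).
  by field.
by rewrite s2 subrK mul1r.
Qed.

Lemma integral_deficit_sum :
  \int[mu]_(t in `[0, 1]) deficit 0 t + \int[mu]_(t in `[0, 1]) deficit 2^-1 t =
  4^-1 * \int[mu]_(t in `[0, 1]) (g t ^+ 2 - 4 * pi ^+ 2 * f t ^+ 2) + pi ^+ 2.
Proof.
have cc (k : R) : {within `[0, 1], continuous (fun _ : R => k)}.
  by apply: continuous_within; exact: cst_continuous.
have f2i : mu.-integrable `[0, 1] (EFin \o (fun t => 4 * pi ^+ 2 * f t ^+ 2)).
  apply: integrable_continuousM => //; apply: within_continuous_integrable.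
  by apply: continuous_within => t; apply: (continuousM (@cf t) (@cf t)).
have ii := integrable_EFinB g2i f2i.
rewrite -RintegralD//; [|exact: integrable_deficit|exact: integrable_deficit].
transitivity (\int[mu]_(t in `[0, 1])
    (4^-1 * (g t ^+ 2 - 4 * pi ^+ 2 * f t ^+ 2) + pi ^+ 2)).
  by apply: eq_Rintegral => t _; exact: deficit_sum.
rewrite RintegralD//.
- rewrite RintegralZl// Rintegral_cst//= lebesgue_measure_itv/= lte_fin ltr01 sube0/=.
  by rewrite mulr1.
- exact: integrable_continuousM.
- exact: within_continuous_integrable.
Qed.

Lemma action_ge : - (4 * pi ^+ 2) <=
  \int[mu]_(t in `[0, 1]) (g t ^+ 2 - 4 * pi ^+ 2 * f t ^+ 2).
Proof.
have := addr_ge0 integral_deficit0_ge0 integral_deficit_half_ge0.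
rewrite integral_deficit_sum => h.
rewrite -subr_ge0 opprK -(@pmulr_rge0 _ 4^-1) ?invr_gt0// mulrDr.
by rewrite mulKf.
Qed.

Lemma integral_deficit0_eq0 :
  \int[mu]_(t in `[0, 1]) (g t ^+ 2 - 4 * pi ^+ 2 * f t ^+ 2) = - (4 * pi ^+ 2) ->
  \int[mu]_(t in `[0, 1]) deficit 0 t = 0.
Proof.
move=> e; have := integral_deficit_sum; rewrite e mulrN mulKf// addNr => /eqP.
rewrite paddr_eq0 ?integral_deficit0_ge0 ?integral_deficit_half_ge0//.
by move=> /andP[/eqP].
Qed.

(** A form of Cauchy-Schwarz: [|c q| <= k c^2 + k^-1 q^2] for every [k > 0]. The choice
    [k = e / (c2 + 1)] brings the first term below [e] while the second integrates to 0. *)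
Lemma Rintegral_mul_eq0 (c q : R -> R) x y : x <= y ->
  {within `[x, y], continuous c} ->
  mu.-integrable `[x, y] (EFin \o (fun t => c t * q t)) ->
  mu.-integrable `[x, y] (EFin \o (fun t => q t ^+ 2)) ->
  \int[mu]_(t in `[x, y]) (q t ^+ 2) = 0 ->
  \int[mu]_(t in `[x, y]) (c t * q t) = 0.
Proof.
move=> xy cc cqi q2i q0.
have c2i : mu.-integrable `[x, y] (EFin \o (fun t => c t * c t)).
  by apply: within_continuous_integrable; exact: within_continuousM.
have kc (k : R) (h : R -> R) : mu.-integrable `[x, y] (EFin \o h) ->
    mu.-integrable `[x, y] (EFin \o (fun t => k * h t)).
  by apply: integrable_continuousM; apply: continuous_within; exact: cst_continuous.
set c2 := \int[mu]_(t in `[x, y]) (c t * c t).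
have c20 : 0 <= c2.
  by apply: Rintegral_ge0 => t _; rewrite -expr2 sqr_ge0.
apply/eqP; rewrite -normr_le0; apply/ler_addgt0Pr => e e0; rewrite add0r.
pose k := e / (c2 + 1).
have k0 : 0 < k by rewrite divr_gt0// ltr_wpDl.
apply: (le_trans (le_normr_Rintegral _ cqi)) => //.
apply: (@le_trans _ _ (\int[mu]_(t in `[x, y]) (k * (c t * c t) + k^-1 * q t ^+ 2))).
  apply: le_Rintegral => //.
  - exact: integrable_norm.
  - by apply: integrable_EFinD; exact: kc.
  move=> t _; rewrite -[q t ^+ 2]real_normK ?num_real// normrM -expr2.
  rewrite -[c t ^+ 2]real_normK ?num_real//.
  move: `|c t| `|q t| (normr_ge0 (c t)) (normr_ge0 (q t)) => a b a0 b0.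
  rewrite -subr_ge0.
  have -> : k * a ^+ 2 + k^-1 * b ^+ 2 - a * b =
      k * ((a - b / (2 * k)) ^+ 2) + 3 / 4 * k^-1 * b ^+ 2.
    by field; rewrite gt_eqF.
  apply: addr_ge0; first by rewrite mulr_ge0 ?sqr_ge0// ltW.
  by rewrite !mulr_ge0 ?sqr_ge0 ?invr_ge0// ltW.
rewrite RintegralD//; [|exact: kc|exact: kc].
rewrite !RintegralZl// q0 mulr0 addr0 -/c2 /k mulrAC ler_pdivrMr ?ltr_wpDl//.
by rewrite ler_pM2l// lerDl.
Qed.

(** * The case of equality *)

Hypothesis deficit0 : \int[mu]_(t in `[0, 1]) deficit 0 t = 0.

Notation p0 := (phi 0).

Lemma sn0_gt0 t : 0 < t < 1 -> 0 < sn 0 t.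
Proof.
move=> /andP[t0 t1]; have p0 := pi_gt0 R; rewrite /sn subr0.
by apply: sin_gt0_pi; rewrite mulr_gt0//= gtr_pMr.
Qed.

(** The lower bounds on [[0, x]], [[x, y]] and [[y, 1]] telescope to 0, because [boundary] vanishes
    at 0 and 1. As the total is 0, each bound is attained. *)
Lemma defect_root_eq0 x y : 0 < x -> x <= y -> y < 1 ->
  mu.-integrable `[x, y] (EFin \o (fun t => defect_root 0 p0 t ^+ 2)) /\
  \int[mu]_(t in `[x, y]) (defect_root 0 p0 t ^+ 2) = 0.
Proof.
move=> x0 xy y1.
have y0 := lt_le_trans x0 xy; have x1 := le_lt_trans xy y1.
have [||||qi qE] := @completing_the_square 0 p0 x y; rewrite ?(ltW x0) ?(ltW y1)//.
  move=> t /andP[xt ty]; rewrite gt_eqF// sn_phi0_gt0//.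
  by rewrite (lt_le_trans x0)// (le_lt_trans ty).
split => //; rewrite -qE.
have Di := integrable_deficit 0.
have l := integral_deficit0_ge (lexx 0) (ltW x0) (ltW x1).
have r := integral_deficit0_ge (ltW y0) (ltW y1) (lexx 1).
have m := integral_deficit0_ge (ltW x0) xy (ltW y1).
move: deficit0.
rewrite (Rintegral_itv_cat (lexx 0) (ltW x0) (ltW x1) (lexx 1) Di).
rewrite (Rintegral_itv_cat (ltW x0) xy (ltW y1) (lexx 1) Di).
move: l r; rewrite (boundary_sn0 p0 (sn_self 0)) (boundary_sn0 p0 sn01) subr0 sub0r.
move: m; move: (boundary _ _ _) (boundary _ _ _) => By Bx.
move: (\int[mu]_(t in `[0, x]) _) (\int[mu]_(t in `[x, y]) _) (\int[mu]_(t in `[y, 1]) _).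
move=> I J K m l r e; apply/eqP; rewrite eq_le; apply/andP; split; lra.
Qed.

(** The equation [defect_root = 0] says that [y / sin (pi (s - p0))] is constant. Its square [f * W]
    has density [c * defect_root] with [c] continuous on [[x, y]], whose integral vanishes. *)
Lemma ratio_cst x y : 0 < x -> x <= y -> y < 1 ->
  f y * (sn 0 y / sn_phi p0 y) ^+ 2 = f x * (sn 0 x / sn_phi p0 x) ^+ 2.
Proof.
move=> x0 xy y1.
have s0 t : x <= t <= y -> sn_phi p0 t != 0.
  move=> /andP[xt ty]; rewrite gt_eqF// sn_phi0_gt0//.
  by rewrite (lt_le_trans x0)// (le_lt_trans ty).
pose W t := (sn 0 t / sn_phi p0 t) ^+ 2.
pose w t := 2 * pi * (sn 0 t * (cs 0 t * sn_phi p0 t - sn 0 t * (f t * cs_phi p0 t))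
   / (sn_phi p0 t * (sn_phi p0 t * sn_phi p0 t))).
have dW t : x <= t <= y -> is_derive t (1 : R) W (w t).
  move=> /s0 st; rewrite /W.
  have d1 := is_derive_sn 0 t; have d2 := is_derive_sn_phi p0 t.
  derive1; rewrite /w; move: st.
  move: (sn 0 t) (cs 0 t) (f t) (cs_phi p0 t) (sn_phi p0 t) (pi : R) => S C F k s P st.
  by field.
have cM (a b : R -> R) t : {for t, continuous a} -> {for t, continuous b} ->
    {for t, continuous (fun t => a t * b t)}.
  by move=> ca cb; apply: continuousM.
have cV (b : R -> R) t : {for t, continuous b} -> b t != 0 ->
    {for t, continuous (fun t => (b t)^-1)}.
  by move=> cb bt; exact: continuousV.
have cB (a b : R -> R) t : {for t, continuous a} -> {for t, continuous b} ->
    {for t, continuous (fun t => a t - b t)}.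
  by move=> ca cb; apply: continuousB.
have cc (k : R) : continuous (fun _ : R => k) by exact: cst_continuous.
have cS := @continuous_sn 0; have cC := @continuous_cs 0.
have cs' := @continuous_sn_phi p0; have ck := @continuous_cs_phi p0.
have cw : {within `[x, y], continuous w}.
  apply: continuous_in_subspaceT => t; rewrite inE/= in_itv/= => /s0 st.
  have c1 := cB _ _ t (cM _ _ t (cC t) (cs' t))
    (cM _ _ t (cS t) (cM _ _ t (@cf t) (ck t))).
  have c2 := cV _ t (cM _ _ t (cs' t) (cM _ _ t (cs' t) (cs' t)))
    (mulf_neq0 st (mulf_neq0 st st)).
  exact (cM (fun=> 2 * pi) _ t (cc _ _) (cM _ _ t (cM _ _ t (cS t) c1) c2)).
have pW : primitive_on x y W w by exact: continuous_primitive_on.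
have [_ Bi /(_ x y (lexx x) xy (lexx y))] :=
  primitive_onM (primitive_on_sub (ltW x0) (ltW y1) pf) pW.
pose c t := f t * (2 * sn 0 t) / (sn_phi p0 t * sn_phi p0 t).
have E t : x <= t <= y -> W t * (f t * g t) + f t * w t = c t * defect_root 0 p0 t.
  move=> /s0; rewrite /W /w /c /defect_root.
  move: (sn 0 t) (cs 0 t) (f t) (cs_phi p0 t) (sn_phi p0 t) (pi : R) (g t).
  by move=> S C F k s P u st; field.
rewrite -/(W y) -/(W x) => e; apply/eqP; rewrite -subr_eq0 e; apply/eqP.
have [qi q0] := defect_root_eq0 x0 xy y1.
transitivity (\int[mu]_(t in `[x, y]) (c t * defect_root 0 p0 t)).
  by apply: eq_Rintegral => t; rewrite inE/= in_itv/= => /E.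
apply: Rintegral_mul_eq0 => //.
  apply: continuous_in_subspaceT => t; rewrite inE/= in_itv/= => /s0 st.
  have c2 := cV _ t (cM _ _ t (cs' t) (cs' t)) (mulf_neq0 st st).
  exact (cM _ _ t (cM _ _ t (@cf t) (cM _ _ t (cc 2 t) (cS t))) c2).
apply: eq_integrable Bi => // t.
by rewrite inE/= in_itv/= => /E ->.
Qed.

(** By [ratio_cst], [f / sn_phi p0 ^+ 2 = k / sn 0 ^+ 2], so [cot (pi (phi t - phi 0))] and
    [k * cot (pi t)] have the same derivative for [0 < t < 1]. Cleared of denominators, the relation
    also holds at 0 and is invariant under [t + 1], since all four functions change sign. *)
Lemma cot_affine : exists2 k : R, 0 < k & exists d : R, forall t,
  cs_phi p0 t * sn 0 t = (k * cs 0 t + d * sn 0 t) * sn_phi p0 t.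
Proof.
have h0 : (0 : R) < 2^-1 by rewrite invr_gt0.
have h1 : 2^-1 < (1 : R) by rewrite invf_lt1// ltr1n.
pose h t := f t * (sn 0 t / sn_phi p0 t) ^+ 2.
have hE t : 0 < t < 1 -> h t = h 2^-1.
  move=> /andP[t0 t1]; have [tl|/ltW tr] := leP t 2^-1.
    by rewrite /h (ratio_cst t0 tl h1).
  by rewrite /h (ratio_cst h0 tr t1).
have S0 t : 0 < t < 1 -> 0 < sn 0 t := @sn0_gt0 t.
have s0 t : 0 < t < 1 -> 0 < sn_phi p0 t := @sn_phi0_gt0 t.
have h01 : 0 < (2^-1 : R) < 1 by rewrite h0.
have k0 : 0 < h 2^-1.
  by rewrite /h mulr_gt0 ?exprn_gt0// divr_gt0 ?S0 ?s0.
exists (h 2^-1) => //; set k := h 2^-1 in k0 hE *.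
pose F t := cs_phi p0 t / sn_phi p0 t - k * (cs 0 t / sn 0 t).
have dF t : 0 < t < 1 -> is_derive t (1 : R) F 0.
  move=> t01; have St : sn 0 t != 0 by rewrite gt_eqF// S0.
  have st : sn_phi p0 t != 0 by rewrite gt_eqF// s0.
  have d1 := is_derive_sn 0 t; have d2 := is_derive_sn_phi p0 t.
  have d3 := is_derive_cs 0 t; have d4 := is_derive_cs_phi p0 t.
  rewrite /F; derive1.
  have S2 : sn 0 t ^+ 2 = 1 - cs 0 t ^+ 2 by exact: sin2cos2.
  have := sn_phi2 p0 t; have := hE t t01; rewrite /h.
  move: (sn 0 t) (cs 0 t) (f t) (cs_phi p0 t) (sn_phi p0 t) (pi : R) S2 St st.
  move=> S C u kp s P S2 St st <- s2.
  transitivity (- P * u * (s ^+ 2 + kp ^+ 2) / s ^+ 2 +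
     P * u * (S ^+ 2 + C ^+ 2) / s ^+ 2); first by field; rewrite st.
  by rewrite s2 S2 !subrK; ring.
have Fcst x y : 0 < x -> x <= y -> y < 1 -> F y = F x.
  move=> x0 xy y1.
  have dFxy t : x <= t <= y -> is_derive t (1 : R) F 0.
    move=> /andP[xt ty]; apply: dF.
    by rewrite (lt_le_trans x0 xt) (le_lt_trans ty).
  have c0 : {within `[x, y], continuous (fun _ : R => 0 : R)}.
    by apply: continuous_within; exact: cst_continuous.
  have [_ _ /(_ x y (lexx x) xy (lexx y))] := continuous_primitive_on dFxy c0.
  by rewrite Rintegral_cst// mul0r => /eqP; rewrite subr_eq0 => /eqP.
exists (F 2^-1) => t.
pose P s := cs_phi p0 s * sn 0 s = (k * cs 0 s + F 2^-1 * sn 0 s) * sn_phi p0 s.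
have Pin s : 0 <= s < 1 -> P s.
  rewrite le_eqVlt => /andP[/predU1P[<-|s0' s1]].
    have s00 : sn_phi p0 0 = 0 by rewrite /sn_phi subrr mulr0 sin0.
    by rewrite /P sn_self s00 !mulr0.
  have s01 : 0 < s < 1 by rewrite s0'.
  have Fs : F s = F 2^-1.
    have [sl|/ltW sr] := leP s 2^-1; last exact: Fcst.
    by rewrite (Fcst _ _ s0' sl h1).
  rewrite /P -Fs /F; have St := S0 s s01; have st := s0 s s01.
  by field; rewrite !gt_eqF.
have PD s : P (s + 1) <-> P s.
  rewrite /P /cs_phi /sn_phi /sn /cs phiD1.
  have -> : pi * (phi s + 1 - p0) = pi * (phi s - p0) + pi by ring.
  have -> : pi * (s + 1 - 0) = pi * (s - 0) + pi by ring.
  by rewrite !sinDpi !cosDpi mulrNN (mulrN k) (mulrN (F 2^-1)) -opprD mulrNN.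
have PDn n s : P (s + n%:R) <-> P s.
  elim: n => [|n ih]; first by rewrite addr0.
  by rewrite -natr1 addrA; split=> [/PD/ih//|/ih/PD].
have tr := ge_floor t; have tl := lt_succ_floor t.
rewrite -/(P t).
have Pf : P (t - (Num.floor t)%:~R).
  by apply: Pin; rewrite subr_ge0 tr/= ltrBlDl -intrD1.
case: (Num.floor t) Pf => [n|n] Pf.
  by have := (PDn n (t - n%:R)).2 Pf; rewrite subrK.
by have /PDn : P (t + n.+1%:R) by rewrite -[n.+1%:R]opprK; exact: Pf.
Qed.

End CompletingTheSquare.

(** * Automorphisms of the disk *)

Section DiskAutomorphism.
Context {R : realType}.
Implicit Types (c d w z : R[i]).

(** The matrix with entries [w * d^*], [w * c^*], [c], [d] is, for [|c| < |d|], a scalar multiple of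
    an element of SU(1,1); this is its invariance of [|z|^2 - 1] in homogeneous form. *)
Lemma su11_norm w c d z : `|w| = 1 ->
  `|w * d^* * z + w * c^*| ^+ 2 - `|c * z + d| ^+ 2 =
  (`|d| ^+ 2 - `|c| ^+ 2) * (`|z| ^+ 2 - 1).
Proof.
move=> w1; rewrite -mulrA -mulrDr normrM w1 mul1r !normCK.
by rewrite !(rmorphD, rmorphM) /= !conjCK; ring.
Qed.

Lemma su11_denom_neq0 c d z : `|c| < `|d| -> `|z| <= 1 -> c * z + d != 0.
Proof.
move=> cd z1; apply/eqP => /eqP; rewrite addr_eq0 => /eqP e.
have : `|d| <= `|c|.
  by rewrite -normrN -e normrM ler_piMr.
by move=> /(lt_le_trans cd); rewrite ltxx.
Qed.

Lemma su11_disk w c d z : `|w| = 1 -> `|c| < `|d| -> `|z| < 1 ->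
  `|w * d^* * z + w * c^*| < `|c * z + d|.
Proof.
move=> w1 cd z1.
rewrite -(@ltr_pXn2r _ 2)// ?nnegrE// -subr_lt0 su11_norm//.
rewrite pmulr_rlt0 ?subr_lt0; first by rewrite expr_lt1.
by rewrite subr_gt0 ltr_pXn2r ?nnegrE.
Qed.

Lemma su11_automorphism w c d : `|w| = 1 -> `|c| < `|d| ->
  set_bij unit_disk unit_disk (mobius (w * d^*) (w * c^*) c d).
Proof.
move=> w1 cd.
have w0 : w != 0 by rewrite -normr_gt0 w1.
have det : d * d^* - c * c^* != 0.
  rewrite -!normCK gt_eqF// subr_gt0 ltr_pXn2r ?nnegrE//.
have ww : w * w^* = 1 by rewrite -normCK w1 expr1n.
split.
- move=> z /= z1; rewrite /unit_disk /mobius /= normrM normfV.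
  have den : 0 < `|c * z + d| by rewrite normr_gt0 su11_denom_neq0// ltW.
  by rewrite ltr_pdivrMr// mul1r; exact: su11_disk.
- move=> z z' /set_mem/= z1 /set_mem/= z'1 /eqP.
  rewrite /mobius eqr_div ?su11_denom_neq0 ?ltW//.
  rewrite -subr_eq0 => /eqP e; apply/eqP; rewrite -subr_eq0.
  have : w * (d * d^* - c * c^*) * (z - z') = 0 by rewrite -[RHS]e; ring.
  by move/eqP; rewrite !mulf_eq0 (negbTE w0) (negbTE det).
- move=> u /= u1.
  have cd' : `|- (w^* * c)^* | < `|(w * d^*)^* |.
    by rewrite normrN !norm_conjC !normrM !norm_conjC w1 !mul1r.
  have den : - c * u + w * d^* != 0.
    apply: su11_denom_neq0; last exact: ltW.
    by rewrite normrN normrM w1 mul1r norm_conjC.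
  (* The inverse matrix has the same shape, with parameters [w], [- c] and [w * d^*], so [su11_disk]
     bounds this preimage too. *)
  exists ((d * u - w * c^*) / (- c * u + w * d^*)).
    rewrite /unit_disk /= normrM normfV ltr_pdivrMr ?normr_gt0// mul1r.
    have := @su11_disk w (- c) (w * d^*) u w1; rewrite normrN normrM w1 mul1r norm_conjC.
    move=> /(_ cd u1); congr (`|_| < _).
    rewrite !(rmorphM, rmorphN) /= conjCK mulrA ww mul1r.
    by rewrite mulrN.
  rewrite /mobius.
  have E : c * ((d * u - w * c^*) / (- c * u + w * d^*)) + d =
      w * (d * d^* - c * c^*) / (- c * u + w * d^*).
    by field.
  by rewrite E; field; rewrite den w0 det.
Qed.

Lemma circle_pointD (s t : R) : circle_point (s + t) = circle_point s * circle_point t.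
Proof.
apply/eqP; rewrite eq_complex /circle_point /= mulrDr cosD sinD eqxx/=.
by rewrite addrC.
Qed.

Lemma norm_circle_point (t : R) : `|circle_point t| = 1.
Proof.
by rewrite /circle_point normc_def /= cos2Dsin2 sqrtr1.
Qed.

Lemma circle_pointE (t : R) : circle_point t =
  ((cos (pi * t) ^+ 2 - sin (pi * t) ^+ 2) +i* (2 * (sin (pi * t) * cos (pi * t))))%C.
Proof.
rewrite /circle_point -mulrA mulr_natl cos_mulr2n sin_mulr2n sin2cos2.
by congr (_ +i* _)%C; ring.
Qed.

(* The hypothesis is [cot (pi s) = k cot (pi t) + d] without denominators; the coefficients come
   from [cot (pi t) = i (z + 1) / (z - 1)] with [z = circle_point t]. *)
Lemma cot_affine_circle_point (k d : R) (s t : R) :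
  cos (pi * s) * sin (pi * t) =
    (k * cos (pi * t) + d * sin (pi * t)) * sin (pi * s) ->
  circle_point s * (((k - 1) -i* d)%C * circle_point t + ((k + 1) +i* d)%C) =
  ((k + 1) -i* d)%C * circle_point t + ((k - 1) +i* d)%C.
Proof.
rewrite !circle_pointE; have := cos2Dsin2 (pi * s); have := cos2Dsin2 (pi * t).
move: (cos (pi * s)) (sin (pi * s)) (cos (pi * t)) (sin (pi * t)) => K s' C S CS Ks e.
have {}e : K * S - (k * C + d * S) * s' = 0 by rewrite e subrr.
have {}CS : C ^+ 2 + S ^+ 2 - 1 = 0 by rewrite CS subrr.
have {}Ks : K ^+ 2 + s' ^+ 2 - 1 = 0 by rewrite Ks subrr.
apply/eqP; rewrite eq_complex /=; apply/andP; split; rewrite -subr_eq0; apply/eqP.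
- transitivity (4 * (K * S + s' * C) * (K * S - (k * C + d * S) * s') +
    2 * (C * (k * C + d * S) - S ^+ 2) * (K ^+ 2 + s' ^+ 2 - 1) +
    (C ^+ 2 + S ^+ 2 - 1) *
      ((k - 1) + 2 * d * s' * K - (k + 1) * (K ^+ 2 - s' ^+ 2))).
    by ring.
  by rewrite e CS Ks !mulr0 mul0r !addr0.
- transitivity (4 * (s' * S - K * C) * (K * S - (k * C + d * S) * s') +
    2 * S * (k * C + d * S + C) * (K ^+ 2 + s' ^+ 2 - 1) +
    (C ^+ 2 + S ^+ 2 - 1) *
      (d - 2 * (k + 1) * s' * K - d * (K ^+ 2 - s' ^+ 2))).
    by ring.
  by rewrite e CS Ks !mulr0 mul0r !addr0.
Qed.

(** The cotangent relation describes [circle_point (phi t - phi 0)] by a matrix of the SU(1,1) shape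
    with [w = 1]; the rotation by [circle_point (phi 0)] restores the base point. Since
    [|d'|^2 - |c|^2 = 4 k], positivity of [k] is what sends the disk to itself. *)
Lemma cot_affine_PSL2R (phi : R -> R) (k d : R) : 0 < k ->
  (forall t, cos (pi * (phi t - phi 0)) * sin (pi * (t - 0)) =
    (k * cos (pi * (t - 0)) + d * sin (pi * (t - 0))) * sin (pi * (phi t - phi 0))) ->
  PSL2R_circle phi.
Proof.
move=> k0 e; pose w := circle_point (phi 0).
pose c : R[i] := ((k - 1) -i* d)%C; pose d' : R[i] := ((k + 1) +i* d)%C.
have w1 : `|w| = 1 by exact: norm_circle_point.
have cd : `|c| < `|d'|.
  rewrite !normc_def /= ltcR ltr_sqrt; last first.
    by rewrite ltr_pwDl ?sqr_ge0// exprn_gt0// ltr_wpDl// ltW.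
  rewrite sqrrN ltrD2r -subr_gt0.
  have -> : (k + 1) ^+ 2 - (k - 1) ^+ 2 = 4 * k by ring.
  by rewrite mulr_gt0.
have den z : `|z| <= 1 -> c * z + d' != 0 by exact: su11_denom_neq0.
exists (w * d'^*), (w * c^*), c, d'; split.
- have w0 : w != 0 by rewrite -normr_gt0 w1.
  have -> : w * d'^* * d' - w * c^* * c = w * (`|d'| ^+ 2 - `|c| ^+ 2).
    by rewrite !normCK; ring.
  by rewrite mulf_neq0// gt_eqF// subr_gt0 ltr_pXn2r ?nnegrE.
- exact: den.
- exact: su11_automorphism.
move=> t; have := e t; rewrite subr0 => /cot_affine_circle_point et.
rewrite -[phi t](subrK (phi 0)) circle_pointD mulrC -/w /mobius.
have den1 : c * circle_point t + d' != 0 by rewrite den// norm_circle_point.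
have cc : c^* = ((k - 1) +i* d)%C by apply/eqP; rewrite eq_complex /= opprK !eqxx.
have dc : d'^* = ((k + 1) -i* d)%C by [].
rewrite -cc -dc -/c -/d' in et.
by apply: (mulIf den1); rewrite mulfVK// -[LHS]mulrA et; ring.
Qed.

End DiskAutomorphism.

(** * The action of Moebius transformations *)

Section MobiusAction.
Context {R : realType}.
Notation mu := (@lebesgue_measure R).
Implicit Types (f g h phi : R -> R) (t x y : R).

(** Lebesgue differentiation applied to the extension [k] of [h] by zero: all its integrals from
    [-oo] vanish, and [k] is almost everywhere their derivative. *)
Lemma ae_eq0_of_primitive h : mu.-integrable `[0, 1] (EFin \o h) ->
  (forall y, 0 <= y -> y <= 1 -> \int[mu]_(t in `[0, y]) h t = 0) ->
  \forall t \ae mu, `[0, 1]%classic t -> h t = 0.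
Proof.
move=> hi h0.
pose k := h \_ `[0, 1]%classic.
have kiT : mu.-integrable setT (EFin \o k).
  by rewrite /k -restrict_EFin; apply/integrable_restrict => //=; rewrite setTI.
have ki y : mu.-integrable `]-oo, y] (EFin \o k) by exact: integrableS kiT.
have lk : locally_integrable [set: R] k by exact: integrable_locally.
have k0 : (fun x => \int[mu]_(t in `]-oo, x]) k t) = cst 0.
  apply/funext => x; rewrite /k -Rintegral_mkcondr.
  have [x0|x0] := ltP x 0.
    rewrite (_ : _ `&` _ = set0) ?Rintegral_set0//.
    apply/seteqP; split => // t /=; rewrite !in_itv/= => -[tx /andP[t0 _]].
    by move: (le_lt_trans tx x0); rewrite ltNge t0.
  rewrite (_ : _ `&` _ = `[0, Num.min x 1]%classic).
    by rewrite h0 ?le_min ?x0 ?ler01 ?ge_min ?lexx ?orbT.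
  apply/seteqP; split => t /=; rewrite !in_itv/= le_min.
    by move=> [-> /andP[-> ->]].
  by move=> /and3P[-> -> ->].
have := FTC1Ny ki lk; apply: filterS; first exact: (ae_filter_ringOfSetsType mu).
move=> x.
rewrite k0 => -[_ kx] x01; move: kx.
by rewrite derive1_cst /k patchE mem_set// => <-.
Qed.

(** [f] is a primitive of both [f * g] and [f * w], where [w = - q' / q] is the classical [(ln f)'];
    as [f > 0], [g = w] almost everywhere. The term [2 * w'] then integrates to 0 by periodicity. *)
Lemma mobius_action (al be ga m : R) f g :
  let q t := al + be * cos (2 * pi * t) + ga * sin (2 * pi * t) in
  0 < m -> m ^+ 2 = al ^+ 2 - be ^+ 2 - ga ^+ 2 ->
  (forall t, 0 < q t) -> (forall t, f t * q t = m) ->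
  primitive_on 0 1 f (fun t => f t * g t) ->
  mu.-integrable `[0, 1] (EFin \o (fun t => g t ^+ 2)) ->
  \int[mu]_(t in `[0, 1]) (g t ^+ 2 - 4 * pi ^+ 2 * f t ^+ 2) = - (4 * pi ^+ 2).
Proof.
move=> q m0 m2 q0 fq pf g2i.
have fE : f = (fun t => m / q t).
  by apply/funext => t; rewrite -(fq t) mulfK// gt_eqF.
pose q' t := 2 * pi * (ga * cos (2 * pi * t) - be * sin (2 * pi * t)).
have dq t : is_derive t (1 : R) q (q' t) by rewrite /q /q'; derive1; ring.
have dq' t : is_derive t (1 : R) q' (4 * pi ^+ 2 * (al - q t)).
  by rewrite /q /q'; derive1; ring.
have cq : continuous q by exact: is_derive_continuous dq.
have cq' : continuous q' by exact: is_derive_continuous dq'.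
have qn t : q t != 0 by rewrite gt_eqF.
pose w t : R := - q' t / q t.
pose w' t : R := - 4 * pi ^+ 2 * (al - q t) / q t - - q' t * q' t / q t ^+ 2.
have dw t : is_derive t (1 : R) w (w' t).
  have d1 := dq t; have d2 := dq' t; have qt := qn t.
  by rewrite /w; derive1; rewrite /w'; field.
have cV : continuous (fun t => (q t)^-1).
  by move=> t; apply: (continuousV (qn t) (@cq t)).
have cM (a b : R -> R) : continuous a -> continuous b -> continuous (fun t => a t * b t).
  by move=> ca cb t; apply: continuousM; [exact: ca|exact: cb].
have cB (a b : R -> R) : continuous a -> continuous b -> continuous (fun t => a t - b t).
  by move=> ca cb t; apply: continuousB; [exact: ca|exact: cb].
have cc (k : R) : continuous (fun _ : R => k) by exact: cst_continuous.
have cw : continuous w by exact: is_derive_continuous dw.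
have cw' : continuous w'.
  have -> : w' = (fun t => (- 4 * pi ^+ 2) * ((al - q t) * (q t)^-1) -
      (- 1) * ((q' t * q' t) * ((q t)^-1 * (q t)^-1))).
    by apply/funext => t; rewrite /w'; have qt := qn t; field.
  apply: (cB); first by apply: (cM) => //; apply: (cM) => //; exact: (cB).
  by apply: (cM) => //; apply: (cM); exact: (cM).
have cf : continuous f by rewrite fE; exact: (cM).
have df t : is_derive t (1 : R) f (f t * w t).
  have d1 := dq t; have qt := qn t.
  by rewrite fE; derive1; rewrite /w; field.
have pw : primitive_on 0 1 f (fun t => f t * w t).
  by apply: continuous_primitive_on => // ; apply: continuous_within; exact: (cM).
have [_ fgi fgE] := pf; have [_ fwi fwE] := pw.
have gw : \forall t \ae mu, `[0, 1]%classic t -> g t = w t.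
  have := @ae_eq0_of_primitive _ (integrable_EFinB fgi fwi) _.
  have h0 y : 0 <= y -> y <= 1 ->
      \int[mu]_(t in `[0, y]) (f t * g t - f t * w t) = 0.
    move=> y0 y1; rewrite RintegralB//; last 2 first.
    - exact: integrable_sub_itv fgi.
    - exact: integrable_sub_itv fwi.
    by rewrite -fgE// -fwE// subrr.
  move=> /(_ h0); apply: filterS; first exact: (ae_filter_ringOfSetsType mu).
  move=> t tP /tP /eqP; rewrite -mulrBr mulf_eq0 fE mulf_eq0 invr_eq0.
  by rewrite (gt_eqF m0) (negbTE (qn t))/= subr_eq0 => /eqP.
have w2i : mu.-integrable `[0, 1] (EFin \o (fun t => w t ^+ 2)).
  by apply: within_continuous_integrable; apply: continuous_within; exact: (cM).
have f2i : mu.-integrable `[0, 1] (EFin \o (fun t => 4 * pi ^+ 2 * f t ^+ 2)).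
  apply: within_continuous_integrable; apply: continuous_within.
  by apply: (cM) => //; exact: (cM).
rewrite RintegralB//.
have -> : \int[mu]_(t in `[0, 1]) (g t ^+ 2) = \int[mu]_(t in `[0, 1]) (w t ^+ 2).
  rewrite /Rintegral; congr fine; apply: ae_eq_integral => //.
  - exact: (measurable_int mu g2i).
  - exact: (measurable_int mu w2i).
  - move: gw; apply: filterS; first exact: (ae_filter_ringOfSetsType mu).
    by move=> t gwt /gwt ->.
rewrite -RintegralB//.
transitivity (\int[mu]_(t in `[0, 1]) (2 * w' t - 4 * pi ^+ 2)).
  apply: eq_Rintegral => t _; rewrite fE /w' /w.
  (* The first integral of [q'' = 4 pi^2 (al - q)]. The relation on [m ^+ 2] turns its constant into
     [al ^+ 2 - m ^+ 2], as the target integrand requires. *)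
  have : q' t ^+ 2 = 4 * pi ^+ 2 * (be ^+ 2 + ga ^+ 2 - (q t - al) ^+ 2).
    have := cos2Dsin2 (2 * pi * t); rewrite /q' /q.
    move: (pi : R) (cos _) (sin _) => P C S CS.
    transitivity (4 * P ^+ 2 * ((be ^+ 2 + ga ^+ 2) * (C ^+ 2 + S ^+ 2) -
      (be * C + ga * S) ^+ 2)); first by ring.
    by rewrite CS; ring.
  have -> : be ^+ 2 + ga ^+ 2 = al ^+ 2 - m ^+ 2 by rewrite m2; ring.
  move: (q t) (q' t) (pi : R) (qn t) => Q Q' P Q0 e.
  transitivity ((Q' ^+ 2 - 4 * P ^+ 2 * m ^+ 2) / Q ^+ 2); first by field.
  transitivity ((2 * Q' ^+ 2 - 4 * P ^+ 2 * Q * (2 * (al - Q) + Q)) / Q ^+ 2); last by field.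
  by rewrite e; field.
have w'i : mu.-integrable `[0, 1] (EFin \o w').
  by apply: within_continuous_integrable; apply: continuous_within.
rewrite RintegralB//; last 2 first.
- by apply: integrable_continuousM => //; apply: continuous_within.
- by apply: within_continuous_integrable; apply: continuous_within.
rewrite RintegralZl// Rintegral_cst//= lebesgue_measure_itv/= lte_fin ltr01 sube0/= mulr1.
have [_ _ /(_ 0 1 (lexx 0) ler01 (lexx 1)) <-] : primitive_on 0 1 w w'.
  by apply: continuous_primitive_on => //; apply: continuous_within.
have -> : w 1 = w 0.
  have pi2 : 2 * pi = pi *+ 2 :> R by rewrite mulr_natl.
  by rewrite /w /q' /q mulr1 [2 * pi * 0]mulr0 pi2 cos2pi sin2pi cos0 sin0.
by rewrite subrr mulr0 sub0r.
Qed.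

End MobiusAction.

(** With [u = exp (2 i pi phi)], differentiating [u (c z + d) = a z + b] gives
    [f (a z + b) = a z - u c z]. Multiplying by the conjugate of [a z + b] and using [a b^* = c d^*]
    leaves [f |c z + d|^2 = |a|^2 - |c|^2]. In real coordinates [X, Y] stand for [z], [U, V] for
    [u], [M1, M2] for [c z + d] and [N1, N2] for [a z + b]. *)
Lemma PSL2R_circle_derivative {R : realType} (phi f : R -> R) :
  (forall t : R, is_derive t (1 : R) phi (f t)) -> (forall t, 0 < f t) ->
  PSL2R_circle phi -> exists al be ga m : R,
  [/\ 0 < m, m ^+ 2 = al ^+ 2 - be ^+ 2 - ga ^+ 2,
    forall t, 0 < al + be * cos (2 * pi * t) + ga * sin (2 * pi * t) &
    forall t, f t * (al + be * cos (2 * pi * t) + ga * sin (2 * pi * t)) = m].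
Proof.
move=> dphi f0 [[a1 a2] [[b1 b2] [[c1 c2] [[d1 d2] [_ den _ phiE]]]]].
pose X t : R := cos (2 * pi * t); pose Y t : R := sin (2 * pi * t).
pose U t : R := cos (2 * pi * phi t); pose V t : R := sin (2 * pi * phi t).
pose M1 t := c1 * X t - c2 * Y t + d1; pose M2 t := c1 * Y t + c2 * X t + d2.
pose N1 t := a1 * X t - a2 * Y t + b1; pose N2 t := a1 * Y t + a2 * X t + b2.
have XY t : X t ^+ 2 + Y t ^+ 2 = 1 by exact: cos2Dsin2.
have UV t : U t ^+ 2 + V t ^+ 2 = 1 by exact: cos2Dsin2.
have eqs t : U t * M1 t - V t * M2 t = N1 t /\ U t * M2 t + V t * M1 t = N2 t.
  have den_t := den (circle_point t); rewrite norm_circle_point in den_t.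
  have : circle_point (phi t) * ((c1 +i* c2)%C * circle_point t + (d1 +i* d2)%C) =
      (a1 +i* a2)%C * circle_point t + (b1 +i* b2)%C.
    by rewrite phiE /mobius mulfVK// den_t.
  move/eqP; rewrite eq_complex /= => /andP[/eqP e1 /eqP e2].
  by split; [exact: e1|exact: e2].
have nm t : N1 t ^+ 2 + N2 t ^+ 2 = M1 t ^+ 2 + M2 t ^+ 2.
  have [<- <-] := eqs t.
  transitivity ((U t ^+ 2 + V t ^+ 2) * (M1 t ^+ 2 + M2 t ^+ 2)); first by ring.
  by rewrite UV mul1r.
have X0 : X 0 = 1 by rewrite /X mulr0 cos0.
have Y0 : Y 0 = 0 by rewrite /Y mulr0 sin0.
have h2 : 2 * pi * 2^-1 = pi :> R by rewrite mulrAC mulfV ?mul1r.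
have X2 : X 2^-1 = -1 by rewrite /X h2 cospi.
have Y2 : Y 2^-1 = 0 by rewrite /Y h2 sinpi.
have h4 : 2 * pi * 4^-1 = pi / 2 :> R.
  by move: (pi : R) => P; field.
have X4 : X 4^-1 = 0 by rewrite /X h4 cos_pihalf.
have Y4 : Y 4^-1 = 1 by rewrite /Y h4 sin_pihalf.
have := nm 4^-1; have := nm 2^-1; have := nm 0.
rewrite /N1 /N2 /M1 /M2 X0 Y0 X2 Y2 X4 Y4 => n0 n2 n4.
(* [|a z + b| = |c z + d|] at [z = 1, -1, i] gives [a b^* = c d^*]. *)
have e1 : a1 * b1 + a2 * b2 = c1 * d1 + c2 * d2 by lra.
have e2 : a1 * b2 - a2 * b1 = c1 * d2 - c2 * d1 by lra.
have e3 : a1 ^+ 2 + a2 ^+ 2 + b1 ^+ 2 + b2 ^+ 2 =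
  c1 ^+ 2 + c2 ^+ 2 + d1 ^+ 2 + d2 ^+ 2 by lra.
clear n0 n2 n4 X0 Y0 X2 Y2 X4 Y4 h2 h4.
pose q t := M1 t ^+ 2 + M2 t ^+ 2.
pose m := (a1 ^+ 2 + a2 ^+ 2) - (c1 ^+ 2 + c2 ^+ 2).
have dX t : is_derive t (1 : R) X (- (2 * pi) * Y t).
  by rewrite /X /Y; derive1; ring.
have dY t : is_derive t (1 : R) Y (2 * pi * X t).
  by rewrite /X /Y; derive1; ring.
have dU t : is_derive t (1 : R) U (- (2 * pi * f t) * V t).
  by have d := dphi t; rewrite /U /V; derive1; ring.
have dV t : is_derive t (1 : R) V (2 * pi * f t * U t).
  by have d := dphi t; rewrite /U /V; derive1; ring.
have fq t : f t * q t = m.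
  have dXt := dX t; have dYt := dY t; have dUt := dU t; have dVt := dV t.
  have dL1 : is_derive t (1 : R) (fun t => U t * M1 t - V t * M2 t)
      (- (2 * pi * f t) * (U t * M2 t + V t * M1 t) +
       2 * pi * (- U t * (c1 * Y t + c2 * X t) - V t * (c1 * X t - c2 * Y t))).
    by rewrite /M1 /M2; derive1; ring.
  have dL2 : is_derive t (1 : R) (fun t => U t * M2 t + V t * M1 t)
      (2 * pi * f t * (U t * M1 t - V t * M2 t) +
       2 * pi * (U t * (c1 * X t - c2 * Y t) - V t * (c1 * Y t + c2 * X t))).
    by rewrite /M1 /M2; derive1; ring.
  have dN1 : is_derive t (1 : R) N1 (2 * pi * (- a1 * Y t - a2 * X t)).
    by rewrite /N1; derive1; ring.
  have dN2 : is_derive t (1 : R) N2 (2 * pi * (a1 * X t - a2 * Y t)).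
    by rewrite /N2; derive1; ring.
  have E1 : (fun t => U t * M1 t - V t * M2 t) = N1.
    by apply/funext => s; have [] := eqs s.
  have E2 : (fun t => U t * M2 t + V t * M1 t) = N2.
    by apply/funext => s; have [] := eqs s.
  rewrite E1 in dL1; rewrite E2 in dL2.
  have D1 := etrans (esym (@derive_val _ _ _ _ _ _ _ dL1)) (@derive_val _ _ _ _ _ _ _ dN1).
  have D2 := etrans (esym (@derive_val _ _ _ _ _ _ _ dL2)) (@derive_val _ _ _ _ _ _ _ dN2).
  have [L1 L2] := eqs t.
  have p0 : 2 * pi != 0 :> R by rewrite mulf_neq0// gt_eqF// pi_gt0.
  pose A := a1 * X t - a2 * Y t; pose B := a1 * Y t + a2 * X t.
  pose C := c1 * X t - c2 * Y t; pose D := c1 * Y t + c2 * X t.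
  have F1 : 2 * pi * (f t * (U t * M1 t - V t * M2 t)) =
      2 * pi * (A - (U t * C - V t * D)).
    apply/eqP; rewrite -subr_eq0; apply/eqP.
    by rewrite /A /C /D -[RHS](subrr (2 * pi * (a1 * X t - a2 * Y t))) -{1}D2; ring.
  have F2 : 2 * pi * (f t * (U t * M2 t + V t * M1 t)) =
      2 * pi * (B - (U t * D + V t * C)).
    apply/eqP; rewrite -subr_eq0; apply/eqP.
    by rewrite /B /C /D -[RHS](subrr (2 * pi * (- a1 * Y t - a2 * X t))) -{2}D1; ring.
  move: F1 F2; rewrite L1 L2 => /(mulfI p0) F1 /(mulfI p0) F2.
  transitivity (N1 t * (f t * N1 t) + N2 t * (f t * N2 t)).
    by rewrite /q -nm; ring.
  rewrite F1 F2.
  transitivity (N1 t * A + N2 t * B - ((U t * M1 t - V t * M2 t) * (U t * C - V t * D)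
      + (U t * M2 t + V t * M1 t) * (U t * D + V t * C))).
    by rewrite L1 L2; ring.
  transitivity (N1 t * A + N2 t * B - (U t ^+ 2 + V t ^+ 2) * (M1 t * C + M2 t * D)).
    by ring.
  rewrite UV /N1 /N2 /M1 /M2 /A /B /C /D.
  transitivity (m * (X t ^+ 2 + Y t ^+ 2) +
    ((a1 * b1 + a2 * b2) - (c1 * d1 + c2 * d2)) * X t +
    ((a1 * b2 - a2 * b1) - (c1 * d2 - c2 * d1)) * Y t); first by rewrite /m; ring.
  by rewrite XY e1 e2 !subrr !mul0r !addr0 mulr1.
have q0 t : 0 < q t.
  have qt0 : q t != 0.
    apply/eqP => qt; have := den (circle_point t).
    rewrite norm_circle_point => /(_ (lexx 1)); apply/negP; rewrite negbK.
    move: qt; rewrite /q => /eqP; rewrite paddr_eq0 ?sqr_ge0// !sqrf_eq0 => /andP[h1 h2].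
    by rewrite eq_complex /=; apply/andP; split; [exact: h1|exact: h2].
  by rewrite lt0r qt0 /q addr_ge0// sqr_ge0.
have m0 : 0 < m by rewrite -(fq 0) mulr_gt0.
pose be := 2 * (c1 * d1 + c2 * d2); pose ga := 2 * (c1 * d2 - c2 * d1).
pose al := c1 ^+ 2 + c2 ^+ 2 + d1 ^+ 2 + d2 ^+ 2.
have qE t : q t = al + be * cos (2 * pi * t) + ga * sin (2 * pi * t).
  rewrite -/(X t) -/(Y t).
  transitivity ((c1 ^+ 2 + c2 ^+ 2) * (X t ^+ 2 + Y t ^+ 2) + d1 ^+ 2 + d2 ^+ 2
    + be * X t + ga * Y t); first by rewrite /q /M1 /M2 /be /ga; ring.
  by rewrite XY /al; ring.
exists al, be, ga, m; split=> // [|t|t]; [|by rewrite -qE|by rewrite -qE].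
(* The pairs [|a|^2, |b|^2] and [|c|^2, |d|^2] have equal sums and products, so
   [(|a|^2 - |d|^2) (|a|^2 - |c|^2) = 0]; the second factor is [m], which is nonzero. *)
have ad : a1 ^+ 2 + a2 ^+ 2 = d1 ^+ 2 + d2 ^+ 2.
  apply/eqP; rewrite -subr_eq0; apply/eqP/(mulfI (negbT (gt_eqF m0))).
  rewrite mulr0 /m.
  transitivity ((c1 * d1 + c2 * d2) ^+ 2 + (c1 * d2 - c2 * d1) ^+ 2 -
    ((a1 * b1 + a2 * b2) ^+ 2 + (a1 * b2 - a2 * b1) ^+ 2) +
    (a1 ^+ 2 + a2 ^+ 2) * ((a1 ^+ 2 + a2 ^+ 2 + b1 ^+ 2 + b2 ^+ 2) -
      (c1 ^+ 2 + c2 ^+ 2 + d1 ^+ 2 + d2 ^+ 2))); first by ring.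
  by rewrite e1 e2 e3 !subrr mulr0 addr0.
rewrite /m ad /al /be /ga; ring.
Qed.

Lemma L2_circle_integrable {R : realType} (g : R -> R) : L2_circle g ->
  (@lebesgue_measure R).-integrable `[0, 1] (EFin \o g).
Proof.
move=> [_ mg g2i].
have c1 : (@lebesgue_measure R).-integrable `[0, 1] (EFin \o (fun=> 1)).
  by apply: within_continuous_integrable; apply: continuous_subspaceT; exact: cst_continuous.
apply: le_integrable (integrable_EFinD c1 g2i) => //.
  by apply/measurable_EFinP; exact: measurable_funTS.
move=> t _ /=; rewrite lee_fin [leRHS]ger0_norm ?addr_ge0 ?sqr_ge0//.
rewrite -(@real_normK _ (g t)) ?num_real//; move: `|g t| => a.
rewrite -subr_ge0; have -> : 1 + a ^+ 2 - a = (a - 2^-1) ^+ 2 + 3 / 4 by field.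
by rewrite addr_ge0 ?sqr_ge0// divr_ge0.
Qed.

Theorem theorem2 (R : realType) (phi : R -> R) (hphi : H_circle phi) :
  - (2 * pi ^+ 2) <= circle_action phi /\
  (circle_action phi = - (2 * pi ^+ 2) <-> PSL2R_circle phi).
Proof.
case: hphi => [[dphi cf phiD1 f0] [_ [g0 g0P]]].
pose f := derive1 phi; pose v := ln_derive1 phi; pose g := weak_derive v.
(* The witness [g0] ensures that [xget] returns a genuine weak derivative and not its default. *)
have [gL2 wd] : L2_circle g /\ is_weak_derivative v g.
  by apply: (@xgetPex _ (cst 0) [set g | L2_circle g /\ is_weak_derivative v g]); exists g0.
have gi := L2_circle_integrable gL2; have [_ _ g2i] := gL2.
have dphi' t : is_derive t (1 : R) phi (f t).
  by rewrite /f derive1E; exact: derivableP.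
have cv : continuous v.
  by move=> t; apply: continuous_comp; [exact: cf|apply: continuous_ln; exact: f0].
(* From here on the weak derivative enters only through [pf] and the integrability of [g] and its
   square. *)
have pf : primitive_on 0 1 f (fun t => f t * g t).
  have evE t : expR (v t) = f t by apply: lnK; rewrite posrE; exact: f0.
  have := primitive_on_expR (weak_derivative_primitive (continuous_subspaceT cv) gi wd).
  rewrite (_ : (fun t => expR (v t) * g t) = (fun t => f t * g t)).
    by rewrite (_ : (fun t => expR (v t)) = f)//; apply/funext.
  by apply/funext => t; rewrite evE.
set I := circle_action phi.
have IE : I = 2^-1 * \int[lebesgue_measure]_(t in `[0, 1])
    (g t ^+ 2 - 4 * pi ^+ 2 * f t ^+ 2) by [].
have eq_value (J : R) : 2^-1 * J = - (2 * pi ^+ 2) <-> J = - (4 * pi ^+ 2).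
  split=> [e|->]; last by field.
  by rewrite -[J](mulKf (x := 2^-1)) ?invr_eq0// e invrK; ring.
split.
  rewrite IE; have := action_ge dphi' cf f0 phiD1 pf gi g2i => h.
  have -> : - (2 * pi ^+ 2) = 2^-1 * - (4 * pi ^+ 2) :> R by field.
  by rewrite ler_pM2l// invr_gt0.
rewrite IE; apply: (iff_trans (eq_value _)); split=> [e|].
  have d0 := integral_deficit0_eq0 dphi' cf f0 phiD1 pf gi g2i e.
  have [k k0 [d relation]] := cot_affine dphi' cf f0 phiD1 pf gi g2i d0.
  exact: cot_affine_PSL2R k0 relation.
move=> /(PSL2R_circle_derivative dphi' f0)[al [be [ga [m [m0 m2 q0 fq]]]]].
exact: mobius_action m0 m2 q0 fq pf g2i.
Qed.
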